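(* Let $a\in(0,1]$, $T>0$, and let $u\in C([0,T];\mathcal Z_{1,1})$ be a solution of the initial value problem $$\begin{cases} u_t+\mathcal H\partial_x^2u+D^{1+a}u+uu_x=0, & x\in\mathbb R,\ t>0,\\ u(x,0)=\phi(x).\end{cases}$$ If there exist two different times $t_1,t_2\in[0,T]$ such that $u(t_j)\in\mathcal Z_{3/2+a,3/2+a}$ for $j=1,2$, then $$\hat u(0,t)=0\quad\text{for all } t\in[0,T],$$ where $\hat u(\xi,t)$ denotes the Fourier transform of $u(\cdot,t)$ in $x$.
   Context: Functions $u(x,t)$ are real-valued. The Fourier transform is $\hat f(\xi)=\int_{\mathbb R}e^{-i\xi x}f(x)\,dx$. $\mathcal H$ is the Hilbert transform, $\widehat{\mathcal Hf}(\xi)=-i\,\mathrm{sgn}(\xi)\hat f(\xi)$, and $\widehat{D^{\alpha}f}(\xi)=|\xi|^{\alpha}\hat f(\xi)$. With $\langle x\rangle=(1+x^2)^{1/2}$, $\mathcal Z_{s,r}=H^s(\mathbb R)\cap L^2(\langle x\rangle^{2r}dx)$ with norm $\|f\|_{\mathcal Z_{s,r}}^2=\|f\|_{H^s}^2+\|\langle x\rangle^{r}f\|_{L^2}^2$. Solutions are understood in the sense of the integral equation $u(t)=U(t)\phi-\int_0^tU(t-\tau)\tfrac12\partial_x(u^2)(\tau)\,d\tau$, where $\widehat{U(t)\phi}(\xi)=e^{-it\xi|\xi|-t|\xi|^{1+a}}\hat\phi(\xi)$. *)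

(* Defs.v *)
From HB Require Import structures.
From mathcomp Require Import all_boot all_order all_algebra.
From mathcomp Require Import all_classical all_reals all_analysis.
From mathcomp.real_closed Require Import complex.

Set Implicit Arguments.
Unset Strict Implicit.
Unset Printing Implicit Defensive.

Import Order.TTheory GRing.Theory Num.Theory.
Import numFieldNormedType.Exports.

Local Open Scope classical_set_scope.
Local Open Scope ring_scope.
Local Open Scope complex_scope.

(* Elements of L^2(R), H^s(R), ... are represented by measurable functions,   *)
(* and equality of such elements is equality almost everywhere.               *)

Section FourierTransform.
Context {R : realType}.
Local Notation mu := (@lebesgue_measure R).

Definition inL2 (f : R -> R) : Prop := f \in Lfun mu 2%:E.

Definition inL2C (g : R -> R[i]) : Prop :=
  inL2 (fun x => complex.Re (g x)) /\ inL2 (fun x => complex.Im (g x)).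

Definition L2norm (f : R -> R) : \bar R := Lnorm mu 2%:E (fun x => (f x)%:E).

Definition L2normC (g : R -> R[i]) : \bar R := L2norm (fun x => Normc.normc (g x)).

(* \int e^{- i xi x} f(x) dx, meaningful for f in L^1. *)
Definition fourier (f : R -> R) (xi : R) : R[i] :=
  (\int[mu]_x (f x * cos (xi * x))) -i* (\int[mu]_x (f x * sin (xi * x))).

(* The L^2 (Plancherel) Fourier transform: g is the L^2-limit of the          *)
(* transforms of the truncations of f, which lie in L^1.                      *)
Definition is_fourierL2 (f : R -> R) (g : R -> R[i]) : Prop :=
  [/\ inL2 f, inL2C g &
      L2normC (fun xi => fourier (f \_ `[- n%:R, n%:R]) xi - g xi)
        @[n --> \oo] --> (0 : \bar R)].

(* is_fourierL2 determines g almost everywhere; this picks a representative. *)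
Definition fourierL2 (f : R -> R) : R -> R[i] :=
  xget (fun _ : R => 0 : R[i]) [set g | is_fourierL2 f g].

(* For real f and g: g is the image of f under the operator of symbol m. *)
Definition is_fourier_multiplier (m : R -> R[i]) (f g : R -> R) : Prop :=
  exists fh gh : R -> R[i], [/\ is_fourierL2 f fh, is_fourierL2 g gh &
    {ae mu, forall xi, gh xi = m xi * fh xi}].

End FourierTransform.

Section FunctionSpaces.
Context {R : realType}.

Definition japanese (x : R) : R := Num.sqrt (1 + x ^+ 2).

(* Meant for s >= 0 only, since f is required to be in L^2. *)
Definition in_sobolev (s : R) (f : R -> R) : Prop :=
  exists g, is_fourierL2 f g /\
    inL2C (fun xi => (japanese xi `^ s)%:C * g xi).

(* || <xi>^s f^ ||_2, without a normalising power of 2 pi. *)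
Definition sobolev_norm (s : R) (f : R -> R) : \bar R :=
  L2normC (fun xi => (japanese xi `^ s)%:C * fourierL2 f xi).

Definition in_weighted_L2 (r : R) (f : R -> R) : Prop :=
  inL2 (fun x => japanese x `^ r * f x).

Definition weighted_L2norm (r : R) (f : R -> R) : \bar R :=
  L2norm (fun x => japanese x `^ r * f x).

Definition in_Z (s r : R) (f : R -> R) : Prop :=
  in_sobolev s f /\ in_weighted_L2 r f.

Definition Z_norm (s r : R) (f : R -> R) : \bar R :=
  ((sobolev_norm s f `^ 2 + weighted_L2norm r f `^ 2) `^ 2^-1)%E.

Definition continuous_in_Z (s r T : R) (u : R -> R -> R) : Prop :=
  (forall t, t \in `[0, T] -> in_Z s r (u t)) /\
  (forall t0, t0 \in `[0, T] ->
    Z_norm s r (fun x => u t x - u t0 x)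
      @[t --> within `[0, T] (nbhs t0)] --> (0 : \bar R)).

End FunctionSpaces.

Section IntegralEquation.
Context {R : realType}.
Local Notation mu := (@lebesgue_measure R).

Definition test_function (psi : R -> R) : Prop :=
  [/\ forall x, derivable psi x 1, continuous (derive1 psi) &
      exists M : R, forall x, M < `|x| -> psi x = 0].

(* Weak derivative, tested against C^1 functions with compact support. *)
Definition is_weak_derivative (f g : R -> R) : Prop :=
  [/\ locally_integrable setT f, locally_integrable setT g &
      forall psi, test_function psi ->
        \int[mu]_x (f x * derive1 psi x) = - \int[mu]_x (g x * psi x)].

Definition cexp (z : R[i]) : R[i] :=
  (expR (complex.Re z) * cos (complex.Im z)) +i* (expR (complex.Re z) * sin (complex.Im z)).

(* g = U(t) f, where U(t) has symbol exp (- i t xi |xi| - t |xi|^(1 + a));    *)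
(* i xi |xi| is the symbol of H d_x^2 and |xi|^(1 + a) that of D^(1 + a).     *)
Definition is_U (a t : R) (f g : R -> R) : Prop :=
  is_fourier_multiplier
    (fun xi => cexp ((- (t * `|xi| `^ (1 + a))) -i* (t * xi * `|xi|))) f g.

Definition riemann_sum (b c : R) (s : seq R) (tag : nat -> R)
    (F : R -> R -> R) (x : R) : R :=
  let p := nth c (b :: s) in
  \sum_(0 <= i < size s) (p i.+1 - p i) * F (tag i) x.

(* G is the L^2-valued Riemann integral of F over [b, c]: the limit in L^2 of *)
(* the tagged Riemann sums as the mesh of the partition tends to 0. For an    *)
(* F continuous from [b, c] to L^2 it is the same as the Bochner integral.    *)
Definition is_L2_integral (b c : R) (F : R -> R -> R) (G : R -> R) : Prop :=
  [/\ forall tau, tau \in `[b, c] -> inL2 (F tau), inL2 G &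
    forall e : R, 0 < e -> exists2 d : R, 0 < d &
      forall (s : seq R) (tag : nat -> R), itv_partition b c s ->
        (forall i, (i < size s)%N ->
           let p := nth c (b :: s) in
           p i.+1 - p i < d /\ tag i \in `[p i, p i.+1]) ->
        (L2norm (fun x => (riemann_sum b c s tag F x - G x)%R) < e%:E)%E].

(* u(t) = U(t) phi - \int_0^t U(t - tau) (1/2) d_x (u^2)(tau) dtau, as an     *)
(* equality in L^2, for all t in [0, T], with                                 *)
(*   w = U(t) phi, v tau = (1/2) d_x (u^2)(tau), F tau = U(t - tau) (v tau)   *)
(* and G the integral.                                                        *)
Definition is_solution (a T : R) (phi : R -> R) (u : R -> R -> R) : Prop :=
  forall t, t \in `[0, T] ->
    exists (w : R -> R) (v F : R -> R -> R) (G : R -> R),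
    [/\ is_U a t phi w,
        forall tau, tau \in `[0, t] ->
          is_weak_derivative (fun x => 2^-1 * u tau x ^+ 2) (v tau) /\
          is_U a (t - tau) (v tau) (F tau),
        is_L2_integral 0 t F G &
        {ae mu, forall x, u t x = w x - G x}].

End IntegralEquation.

(* Main.v *)
Require Import Defs.
From HB Require Import structures.
From mathcomp Require Import all_boot all_order all_algebra.
From mathcomp Require Import all_classical all_reals all_analysis.
From mathcomp.real_closed Require Import complex.
From mathcomp Require Import measurable_realfun ring lra.

Import Order.TTheory GRing.Theory Num.Theory.
Import numFieldNormedType.Exports.
Local Open Scope classical_set_scope.
Local Open Scope ring_scope.

(** A nonzero mass is incompatible with strong decay at two times, because the
    symbol [p xi = i xi |xi| + |xi|^(1 + a)] of the linear part is not smooth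
    enough at [xi = 0].

    Let [c] be the integral of [u 0] and let [^] denote the Fourier transform.
    On the Fourier side the integral equation reads
    [u^(xi, t) = exp (- t p) u^(xi, 0) - N(xi, t)], where [N] is the time
    integral of [exp (- (t - tau) p) i xi q^(xi, tau)] with [q = u^2 / 2].

    - Nonlinear part. As [<x> u] is bounded in L^2 uniformly in time, [x^2 q] is
      bounded in L^1. Hence the real part of [N] is [O(xi^2)], while its
      imaginary part is a multiple of [xi] up to [O(xi^(2 + a))], so that it is
      nearly annihilated by [g |-> g(2 xi) - 2 g(xi)] ([duhamel_bounds]).
      Letting [xi] tend to 0 gives conservation of mass ([mass_conserved]).

    - Linear part. Going from [t1] to [t2] changes the transform by
      [- (t2 - t1) c p(xi) + o(xi^(1 + a))] ([flowRe_expansion] and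
      [flowIm_expansion]).

    - Decay. If [<x>^(3/2 + a) f] is in L^2 and [|k y| <= C min(1, |y|^3)], then
      the integral of [f x * k (xi x)] is [o(xi^(1 + a))] ([kernel_little_o]).
      This is where the exponent [3/2 + a] is used, and it is critical there.

    - Conclusion ([mass_zero]). For [a < 1], the kernel
      [cos (2 y) - 4 cos y + 3] selects the real part, where [|xi|^(1 + a)] is
      multiplied by [2^(1 + a) - 4], which is nonzero, and the [O(xi^2)]
      nonlinear term is negligible. For [a = 1] that factor vanishes, but then
      [sin (2 y) - 2 sin y] selects the imaginary part, where [xi^2] for
      [xi > 0] is multiplied by 2. In both cases a nonzero multiple of
      [(t2 - t1) c xi^(1 + a)] is [o(xi^(1 + a))], so [c = 0].

    The solution and its transform are only related in L^2. Every transform of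
    an L^2 function is therefore handled through its integrals over frequency
    intervals [[al, be]], which equal integrals of the function against the
    square integrable kernels [osc_kernel cos al be] and [osc_kernel sin al be]
    ([weak_fourier]). The values at single frequencies are recovered by
    averaging over [[xi, xi + d]] and letting [d] tend to 0, since the transform
    of [u t] is continuous. *)

Set Implicit Arguments.
Unset Strict Implicit.
Unset Printing Implicit Defensive.

(** * Square integrable functions *)
Section SquareIntegrable.
Context {R : realType}.
Local Notation mu := (@lebesgue_measure R).
Local Notation L1 f := (mu.-integrable setT (EFin \o f)).
Implicit Types f g h : R -> R.

Lemma L1_measurable f : L1 f -> measurable_fun setT f.
Proof. by move=> fi; apply/measurable_EFinP; exact: measurable_int fi. Qed.

Lemma L1Z (r : R) f : L1 f -> L1 (fun x => r * f x).
Proof. by move=> fi; exact: (integrableZl measurableT r fi). Qed.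

Lemma L1D f g : L1 f -> L1 g -> L1 (fun x => f x + g x).
Proof. by move=> fi gi; exact: (integrableD measurableT fi gi). Qed.

Lemma L1B f g : L1 f -> L1 g -> L1 (fun x => f x - g x).
Proof. by move=> fi gi; exact: (integrableB measurableT fi gi). Qed.

Lemma L1_le f g : measurable_fun setT f -> L1 g ->
  (forall x, `|f x| <= g x) -> L1 f.
Proof.
move=> mf ig fg; apply: (le_integrable measurableT) ig.
- exact/measurable_EFinP.
- by move=> x _; rewrite /= lee_fin (le_trans (fg x))// ler_norm.
Qed.

Lemma inL2_measurable f : inL2 f -> measurable_fun setT f.
Proof. by rewrite /inL2 inE => /andP[/set_mem]. Qed.

Lemma inL2_sqr f : inL2 f -> L1 (fun x => f x ^+ 2).
Proof. exact: Lfun2_integrable_sqr. Qed.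

Lemma L2normE f : L2norm f = ((\int[mu]_x (f x ^+ 2)%:E) `^ 2^-1)%E.
Proof.
rewrite /L2norm unlock /Lnorm; congr (_ `^ _)%E; apply: eq_integral => x _ /=.
by rewrite powR_mulrn// real_normK// num_real.
Qed.

Lemma inL2_lty f : inL2 f -> (L2norm f < +oo)%E.
Proof. by rewrite /inL2 inE => /andP[_ /set_mem]. Qed.

Lemma sqr_inL2 f : measurable_fun setT f -> L1 (fun x => f x ^+ 2) -> inL2 f.
Proof.
move=> mf f2; rewrite /inL2 inE; apply/andP; split; apply/mem_set => //=.
rewrite /finite_norm -/(L2norm f) L2normE poweR_lty//.
by have := integrable_lty measurableT f2.
Qed.

Lemma inL2_integrableM f g : inL2 f -> inL2 g -> L1 (fun x => f x * g x).
Proof. by move=> f2 g2; apply/Lfun1_integrable/Lfun2_mul_Lfun1. Qed.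

Lemma inL2_le f g : measurable_fun setT f -> (forall x, `|f x| <= `|g x|) ->
  inL2 g -> inL2 f.
Proof.
move=> mf fg g2; apply: sqr_inL2 => //.
apply: (L1_le _ (inL2_sqr g2)); first exact: measurable_funX.
by move=> x; rewrite normrX -[leRHS]real_normK ?num_real// lerXn2r ?nnegrE.
Qed.

Lemma inL2D f g : inL2 f -> inL2 g -> inL2 (fun x => f x + g x).
Proof. exact: (Lfun_addr_closed mu (lee1n 2)).2. Qed.

Lemma inL2Z (r : R) f : inL2 f -> inL2 (fun x => r * f x).
Proof.
move=> f2; apply: sqr_inL2.
  by apply: measurable_funM => //; exact: inL2_measurable.
rewrite (_ : _ \o _ = EFin \o (fun x => r ^+ 2 * (f x ^+ 2))); last first.
  by apply/funext => x /=; rewrite exprMn.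
by apply: (integrableZl measurableT) (inL2_sqr f2).
Qed.

Lemma inL2B f g : inL2 f -> inL2 g -> inL2 (fun x => f x - g x).
Proof.
move=> f2 g2; rewrite (_ : (fun x => _) = (fun x => f x + (-1) * g x)).
  by apply: inL2D => //; exact: inL2Z.
by apply/funext => x; rewrite mulN1r.
Qed.

Lemma L2norm_le f g : measurable_fun setT f -> measurable_fun setT g ->
  (forall x, `|f x| <= `|g x|) -> (L2norm f <= L2norm g)%E.
Proof.
move=> mf mg fg; rewrite !L2normE gt0_ler_poweR//.
- by rewrite in_itv/= leey integral_ge0// => x _; rewrite lee_fin sqr_ge0.
- by rewrite in_itv/= leey integral_ge0// => x _; rewrite lee_fin sqr_ge0.
apply: ge0_le_integral => //.
- by move=> x _; rewrite lee_fin sqr_ge0.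
- by apply/measurable_EFinP; exact: measurable_funX.
- by apply/measurable_EFinP; exact: measurable_funX.
- move=> x _; rewrite lee_fin -(real_normK (num_real (f x))).
  by rewrite -(real_normK (num_real (g x))) lerXn2r ?nnegrE.
Qed.

Lemma cauchy_schwarz f g : inL2 f -> inL2 g ->
  (`|\int[mu]_x (f x * g x)|%:E <= L2norm f * L2norm g)%E.
Proof.
move=> f2 g2; rewrite EFin_normr_Rintegral//; last exact: inL2_integrableM.
have mfg : measurable_fun setT (fun x => f x * g x).
  by apply: measurable_funM; exact: inL2_measurable.
apply: (le_trans (le_abse_integral _ _ _)) => //; first exact/measurable_EFinP.
have := @hoelder _ _ _ mu f g 2 2 (inL2_measurable f2) (inL2_measurable g2).
by rewrite Lnorm1; apply => //; rewrite [RHS]splitr !div1r.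
Qed.

Lemma L2normD f g : inL2 f -> inL2 g ->
  (L2norm (fun x => (f x + g x)%R) <= L2norm f + L2norm g)%E.
Proof.
move=> f2 g2; apply: (@eminkowski _ _ _ mu f g 2%:E);
  [exact: inL2_measurable|exact: inL2_measurable|by rewrite lee1n].
Qed.

Lemma L2normN f : L2norm (fun x => - f x) = L2norm f.
Proof. by rewrite !L2normE; under eq_integral do rewrite sqrrN. Qed.

Lemma L2norm_sqr f : inL2 f ->
  \int[mu]_x (f x ^+ 2) = fine (L2norm f) ^+ 2.
Proof.
move=> f2; rewrite L2normE /Rintegral.
have : (\int[mu]_x (f x ^+ 2)%:E)%E \is a fin_num.
  exact: (integrable_fin_num measurableT (inL2_sqr f2)).
have : (0 <= \int[mu]_x (f x ^+ 2)%:E)%E.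
  by apply: integral_ge0 => x _; rewrite lee_fin sqr_ge0.
case: (\int[mu]_x _)%E => [r||]//=; rewrite lee_fin => r0 _.
by rewrite -powR_mulrn ?powR_ge0// -powRrM mulVf// powRr1.
Qed.

End SquareIntegrable.

(** * The weights and the profile 1 / (1 + (s x)^2) *)
Section Weights.
Context {R : realType}.
Local Notation mu := (@lebesgue_measure R).
Local Notation L1 f := (mu.-integrable setT (EFin \o f)).
Implicit Types (f : R -> R) (r s x : R).

Lemma continuous_lorentz s : continuous (fun x : R => (1 + (s * x) ^+ 2)^-1).
Proof.
move=> x; apply: cvgV; first by rewrite gt_eqF// ltr_pwDl// sqr_ge0.
apply: cvgD; first exact: cvg_cst.
apply: (@continuous_comp _ _ _ (fun y : R => s * y) (fun y : R => y ^+ 2)).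
  by apply: cvgMl_tmp; exact: cvg_id.
exact: exprn_continuous.
Qed.

Lemma integral_lorentz s : 0 < s ->
  (\int[mu]_x ((1 + (s * x) ^+ 2)^-1)%:E = (pi / s)%:E)%E.
Proof.
move=> s0; have sn0 : s != 0 by rewrite gt_eqF.
have dF x : is_derive x 1 (fun y : R => atan (s * y) / s) ((1 + (s * x) ^+ 2)^-1).
  have dat : is_derive (s * x) 1 (@atan R) ((1 + (s * x) ^+ 2)^-1).
    exact: is_derive1_atan.
  have ds : is_derive x 1 (fun y : R => s * y) s.
    by apply: is_derive_eq; rewrite /GRing.scale /= mulr1.
  have dc := @is_derive1_comp R (@atan R) (fun y => s * y) x _ _ dat ds.
  rewrite (_ : (fun _ => _) = s^-1 \*: (@atan R \o (fun y => s * y))); last first.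
    by apply/funext => y; rewrite /= mulrC.
  apply: is_derive_eq.
  by rewrite /GRing.scale /= mulrCA mulVf// mulr1.
rewrite ge0_symfun_integralT; first last.
- by move=> x /=; rewrite mulrN sqrrN.
- exact: continuous_lorentz.
- by move=> x; rewrite invr_ge0 addr_ge0// sqr_ge0.
rewrite (_ : [set x | 0 <= x] = `[0, +oo[%classic); last first.
  by apply/seteqP; split => x /=; rewrite in_itv/= andbT.
have cF : (fun y => atan (s * y) / s) x @[x --> +oo] --> pi / 2 / s.
  apply: cvgMr_tmp; apply: (cvg_comp _ (@atan R) _ (@cvgy_atan R)).
  apply/cvgryPge => A; near=> x; rewrite mulrC -ler_pdivrMr//.
rewrite (ge0_continuous_FTC2y _ _ cF).
- by rewrite mulr0 atan0 mul0r sube0 -EFinM; congr EFin; field.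
- by move=> x _; rewrite invr_ge0 addr_ge0// sqr_ge0.
- by apply: continuous_subspaceT; exact: continuous_lorentz.
- by move=> x _; exact: ex_derive.
- apply: cvg_at_right_filter; apply: (differentiable_continuous (f := fun y => atan (s * y) / s)).
  by apply/derivable1_diffP; exact: ex_derive.
- by move=> x _; rewrite derive1E; exact: derive_val.
Unshelve. all: by end_near. Qed.

Lemma integrable_lorentz s : 0 < s -> L1 (fun x : R => (1 + (s * x) ^+ 2)^-1).
Proof.
move=> s0; apply/integrableP; split.
  apply/measurable_EFinP; apply: continuous_measurable_fun.
  exact: continuous_lorentz.
under eq_integral do rewrite /= ger0_norm ?invr_ge0 ?addr_ge0 ?sqr_ge0//.
by rewrite integral_lorentz// ltry.
Qed.

Lemma japanese_sqr x : japanese x ^+ 2 = 1 + x ^+ 2.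
Proof. by rewrite sqr_sqrtr// addr_ge0// sqr_ge0. Qed.

Lemma japanese_ge1 x : 1 <= japanese x.
Proof. by rewrite -[leLHS]sqrtr1 ler_wsqrtr// lerDl sqr_ge0. Qed.

Lemma japanese_gt0 x : 0 < japanese x.
Proof. exact: lt_le_trans ltr01 (japanese_ge1 x). Qed.

Lemma japanese_ge_norm x : `|x| <= japanese x.
Proof. by rewrite -sqrtr_sqr ler_wsqrtr// lerDr. Qed.

Lemma measurable_japanese_powR r :
  measurable_fun setT (fun x : R => japanese x `^ r).
Proof.
apply: (measurableT_comp (measurable_powR r)).
apply: continuous_measurable_fun => x.
apply: (@continuous_comp _ _ _ (fun y : R => 1 + y ^+ 2) Num.sqrt).
  by apply: cvgD; [exact: cvg_cst|exact: exprn_continuous].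
exact: sqrt_continuous.
Qed.

Lemma weighted_L2_measurable r f : in_weighted_L2 r f -> measurable_fun setT f.
Proof.
move=> fr.
rewrite (_ : f = fun x => japanese x `^ (- r) * (japanese x `^ r * f x)); last first.
  apply/funext => x; rewrite mulrA -powRD ?addNr ?powRr0 ?mul1r//.
  by rewrite (gt_eqF (japanese_gt0 x)) implybT.
apply: measurable_funM; first exact: measurable_japanese_powR.
exact: inL2_measurable.
Qed.

Lemma weighted_L2S r s f : r <= s -> in_weighted_L2 s f -> in_weighted_L2 r f.
Proof.
move=> rs fs; apply: inL2_le (fs).
  apply: measurable_funM; first exact: measurable_japanese_powR.
  exact: weighted_L2_measurable fs.
move=> x; rewrite !normrM ler_wpM2r// !ger0_norm ?powR_ge0//.
by apply: ler_powR => //; exact: japanese_ge1.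
Qed.

Lemma weighted_L2_inL2 f : in_weighted_L2 1 f -> inL2 f.
Proof.
move=> f1; apply: inL2_le (f1); first exact: weighted_L2_measurable f1.
move=> x; rewrite normrM powRr1 ?(ltW (japanese_gt0 x))//.
by rewrite ler_peMl// (le_trans (japanese_ge1 x))// ler_norm.
Qed.

(** By the inequality [|f| <= (<x> f)^2 + <x>^-2]. *)
Lemma weighted_L2_L1 f : in_weighted_L2 1 f -> L1 f.
Proof.
move=> f1; apply: (@L1_le _ _ (fun x => (japanese x `^ 1 * f x) ^+ 2 + (1 + (1 * x) ^+ 2)^-1)).
- exact: weighted_L2_measurable f1.
- by apply: (integrableD measurableT (inL2_sqr f1) (integrable_lorentz ltr01)).
- move=> x; rewrite powRr1 ?(ltW (japanese_gt0 x))// mul1r -japanese_sqr.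
  have := japanese_gt0 x; set j := japanese x => j0.
  rewrite -[f x in leLHS](mulKf (lt0r_neq0 j0)) normrM gtr0_norm ?invr_gt0//.
  rewrite -exprVn -[(j * f x) ^+ 2]real_normK ?num_real//.
  have : 0 <= (j^-1 - `|j * f x|) ^+ 2 by exact: sqr_ge0.
  have : 0 <= j^-1 * `|j * f x| by rewrite mulr_ge0// invr_ge0 ltW.
  by nra.
Qed.

Lemma weighted_sqr f : in_weighted_L2 1 f ->
  L1 (fun x => (1 + x ^+ 2) * f x ^+ 2) /\
  \int[mu]_x ((1 + x ^+ 2) * f x ^+ 2) = fine (weighted_L2norm 1 f) ^+ 2.
Proof.
move=> f1; rewrite /weighted_L2norm -L2norm_sqr//.
have -> : (fun x => (1 + x ^+ 2) * f x ^+ 2) = (fun x => (japanese x `^ 1 * f x) ^+ 2).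
  by apply/funext => x; rewrite powRr1 ?(ltW (japanese_gt0 x))// exprMn japanese_sqr.
by split => //; exact: inL2_sqr.
Qed.

End Weights.

(** * Oscillating functions integrated over a band of frequencies *)
Section OscillatoryKernels.
Context {R : realType}.
Local Notation mu := (@lebesgue_measure R).
Local Notation L1 f := (mu.-integrable setT (EFin \o f)).
Implicit Types (f k : R -> R) (x y al be xi : R).

(** A common interface for [cos], [sin] and their opposites. The bounded
    primitive is what makes [osc_kernel] decay like [1 / x]. *)
Definition oscillating k := [/\ continuous k, forall y, `|k y| <= 1 &
  exists2 K : R -> R, (forall y, `|K y| <= 1) & forall y, is_derive y 1 K (k y)].

Lemma oscillating_cos : oscillating cos.
Proof.
split; [exact: continuous_cos| |exists sin => y].
- by move=> y; rewrite ler_norml cos_geN1 cos_le1.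
- by rewrite ler_norml sin_geN1 sin_le1.
- exact: is_derive_sin.
Qed.

Lemma oscillating_sin : oscillating sin.
Proof.
split; [exact: continuous_sin| |exists (fun y => - cos y) => y].
- by move=> y; rewrite ler_norml sin_geN1 sin_le1.
- by rewrite normrN ler_norml cos_geN1 cos_le1.
- by apply: is_derive_eq; rewrite opprK.
Qed.

Definition osc_transform k f xi := \int[mu]_x (f x * k (xi * x)).

Definition osc_kernel k al be x := \int[mu]_(xi in `[al, be]) k (xi * x).

Lemma integrable_itv_bounded f al be (M : R) : measurable_fun `[al, be] f ->
  (forall x, x \in `[al, be] -> `|f x| <= M) ->
  mu.-integrable `[al, be] (EFin \o f).
Proof.
move=> mf fM; apply: measurable_bounded_integrable => //.
  by rewrite /= lebesgue_measure_itv/=; case: ifPn => // _; rewrite -EFinB ltry.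
by exists M; split; [rewrite num_real|move=> r Mr x /= xab; apply: le_trans (ltW Mr); apply: fM].
Qed.

Lemma integrable_itv_continuous f al be : continuous f ->
  mu.-integrable `[al, be] (EFin \o f).
Proof.
move=> cf; apply: continuous_compact_integrable; first exact: segment_compact.
exact: continuous_subspaceT.
Qed.

Lemma Rintegral_itv_cst al be (c : R) : al <= be ->
  \int[mu]_(x in `[al, be]) c = (be - al) * c.
Proof.
move=> ab; rewrite Rintegral_cst//= lebesgue_measure_itv/= lte_fin mulrC.
congr (_ * _); move: ab; rewrite le_eqVlt => /predU1P[->|->]//=.
by rewrite ltxx subrr.
Qed.

Lemma Rintegral_itv_le f al be (M : R) : al <= be -> measurable_fun `[al, be] f ->
  (forall x, x \in `[al, be] -> `|f x| <= M) ->
  `|\int[mu]_(x in `[al, be]) f x| <= M * (be - al).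
Proof.
move=> ab mf fM.
have fi := integrable_itv_bounded mf fM.
apply: le_trans (le_normr_Rintegral _ fi) _ => //.
rewrite mulrC -(Rintegral_itv_cst M ab).
apply: le_Rintegral => //.
- exact: (integrable_norm fi).
- apply: integrable_itv_continuous; exact: cst_continuous.
Qed.

Context (k : R -> R) (osck : oscillating k).

Lemma continuous_scaled y : continuous (fun xi => k (xi * y)).
Proof.
case: osck => ck _ _ x; apply: (@continuous_comp _ _ _ (fun xi => xi * y) k).
  by apply: cvgMr_tmp; exact: cvg_id.
exact: ck.
Qed.

Lemma L1_osc f (m : R -> R) : L1 f -> measurable_fun setT m ->
  (forall x, `|m x| <= 1) -> L1 (fun x => f x * m x).
Proof.
move=> fi mm m1; apply: (@L1_le _ _ (fun x => `|f x|)).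
- apply: measurable_funM => //; apply/measurable_EFinP; exact: measurable_int fi.
- exact: (integrable_norm fi).
- by move=> x; rewrite normrM ler_piMr.
Qed.

Lemma L1_osc_scaled f xi : L1 f -> L1 (fun x => f x * k (xi * x)).
Proof.
move=> fi; apply: L1_osc => //.
  apply: continuous_measurable_fun => x.
  by under eq_fun do rewrite mulrC; apply: continuous_scaled.
by case: osck.
Qed.

Lemma osc_transform_le f xi : L1 f ->
  `|osc_transform k f xi| <= \int[mu]_x `|f x|.
Proof.
move=> fi; have ki := L1_osc_scaled xi fi.
apply: le_trans (le_normr_Rintegral _ ki) _ => //.
apply: le_Rintegral => //.
- exact: (integrable_norm ki).
- exact: (integrable_norm fi).
- by move=> x _; rewrite normrM ler_piMr//; case: osck.
Qed.

Lemma continuous_osc_transform f : L1 f -> continuous (osc_transform k f).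
Proof.
move=> fi xi.
apply: (@continuity_under_integral _ _ _ mu (fun xi x => f x * k (xi * x)) setT
  measurableT (xi - 1) (xi + 1) _ _ (fun x => `|f x|)).
- by move=> y _; exact: L1_osc_scaled.
- apply: aeW => x _ y _; apply: cvgMl_tmp; exact: continuous_scaled.
- exact: (integrable_norm fi).
- by move=> y _; apply: aeW => x _; rewrite normrM ler_piMr//; case: osck.
- by rewrite inE/= in_itv/= ltrDl ltrBlDr ltrDl ltr01.
Qed.

Lemma continuous_osc_kernel al be : continuous (osc_kernel k al be).
Proof.
move=> x; rewrite /osc_kernel.
apply: (@continuity_under_integral _ _ _ mu (fun x xi => k (xi * x)) `[al, be]
  _ (x - 1) (x + 1) _ _ (fun=> 1)) => //.
- by move=> y _; apply: integrable_itv_continuous; exact: continuous_scaled.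
- apply: aeW => xi _ y _; under eq_fun do rewrite mulrC; exact: continuous_scaled.
- by apply: integrable_itv_continuous; exact: cst_continuous.
- by move=> y _; apply: aeW => xi _; case: osck.
- by rewrite inE/= in_itv/= ltrDl ltrBlDr ltrDl ltr01.
Qed.

Lemma osc_kernel_le al be x : al <= be -> `|osc_kernel k al be x| <= be - al.
Proof.
move=> ab; rewrite -[leRHS]mul1r; apply: Rintegral_itv_le => //.
  apply: measurable_funTS; apply: continuous_measurable_fun.
  exact: continuous_scaled.
by move=> xi _; case: osck.
Qed.

Lemma osc_kernel_decay al be x : al <= be -> `|x * osc_kernel k al be x| <= 2.
Proof.
rewrite le_eqVlt => /predU1P[->|ab].
  by rewrite /osc_kernel set_itv1 Rintegral_set1 mulr0 normr0.
have [->|x0] := eqVneq x 0; first by rewrite mul0r normr0.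
have [ck k1 [K K1 dK]] := osck.
have dF xi : is_derive xi 1 (fun y => x^-1 * K (y * x)) (k (xi * x)).
  have dm : is_derive xi 1 (fun y : R => y * x) x.
    by apply: is_derive_eq; rewrite scaler0 add0r /GRing.scale/= mulr1.
  have dc := @is_derive1_comp R K (fun y => y * x) xi _ _ (dK _) dm.
  rewrite (_ : (fun _ => _) = x^-1 \*: (K \o (fun y => y * x)))//.
  by apply: is_derive_eq; rewrite /GRing.scale /= mulrCA mulVf// mulr1.
have cF y : {for y, continuous (fun y => x^-1 * K (y * x))}.
  apply: differentiable_continuous.
  by apply/derivable1_diffP; exact: ex_derive.
rewrite /osc_kernel /Rintegral (@continuous_FTC2 _ _ (fun y => x^-1 * K (y * x)))//=.
- rewrite -mulrBr mulrA divff// mul1r (le_trans (ler_normB _ _))//.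
  by rewrite (_ : 2 = 1 + 1)// lerD.
- by apply: continuous_subspaceT; exact: continuous_scaled.
- split.
  + by move=> y _; exact: ex_derive.
  + by apply: cvg_at_right_filter; exact: cF.
  + by apply: cvg_at_left_filter; exact: cF.
- by move=> y _; rewrite derive1E; exact: derive_val.
Qed.

(** The kernel is bounded by the length of the interval near 0 and by [2 / |x|]
    at infinity. Being in L^2, it can be paired with L^2 functions whose Fourier
    integral does not converge absolutely. *)
Lemma inL2_osc_kernel al be : al <= be -> inL2 (osc_kernel k al be).
Proof.
move=> ab; set K := osc_kernel k al be.
have mK : measurable_fun setT K.
  by apply: continuous_measurable_fun; exact: continuous_osc_kernel.
apply: sqr_inL2 => //.
apply: (@L1_le _ _ (fun x => ((be - al) ^+ 2 + 2 ^+ 2) * (1 + (1 * x) ^+ 2)^-1)).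
- exact: measurable_funX.
- by apply: (integrableZl measurableT _ (integrable_lorentz ltr01)).
- move=> x; rewrite ger0_norm ?sqr_ge0// ler_pdivlMr ?ltr_pwDl ?sqr_ge0// mul1r.
  rewrite mulrDr mulr1 -exprMn [_ * x]mulrC.
  rewrite -(real_normK (num_real (K x))) -(real_normK (num_real (x * K x))).
  by rewrite lerD// lerXn2r ?nnegrE ?subr_ge0//; [exact: osc_kernel_le|exact: osc_kernel_decay].
Qed.

(** The indicator of the frequency interval makes
    [f x * k (xi * x)] absolutely integrable in both variables. *)
Lemma fubini_osc f al be : al <= be -> L1 f ->
  \int[mu]_x (f x * osc_kernel k al be x) =
  \int[mu]_(xi in `[al, be]) osc_transform k f xi.
Proof.
move=> ab fi.
have mf : measurable_fun setT f by apply/measurable_EFinP; exact: measurable_int fi.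
have [ck k1 _] := osck.
pose h (z : R * R) := f z.1 * k (z.2 * z.1) * \1_(`[al, be]) z.2.
have mh : measurable_fun setT h.
  apply: measurable_funM; first apply: measurable_funM.
  - exact: measurableT_comp.
  - apply: (@measurableT_comp _ _ _ _ _ _ k); first exact: continuous_measurable_fun.
    by apply: measurable_funM.
  - by apply: measurableT_comp => //; exact: measurable_indic.
have mabs : measurable_fun setT (fun z => `|(h z)%:E|%E).
  by apply: measurableT_comp => //; exact/measurable_EFinP.
have hle x xi : `|h (x, xi)| <= `|f x| * \1_(`[al, be]) xi.
  rewrite /h/= !normrM [X in _ * X]ger0_norm// ler_wpM2r//.
  by rewrite ler_piMr.
have inner x : (\int[mu]_xi (h (x, xi))%:E)%E = (f x * osc_kernel k al be x)%:E.
  rewrite /h/=.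
  transitivity (\int[mu]_(xi in `[al, be]) (f x * k (xi * x))%:E)%E.
    rewrite [RHS]integral_mkcond; apply: eq_integral => xi _.
    rewrite patchE indicE; case: ifPn => _; by rewrite ?mulr1 ?mulr0.
  have ik : mu.-integrable `[al, be] (fun xi => (k (xi * x))%:E).
    by apply: integrable_itv_continuous; exact: continuous_scaled.
  under eq_integral do rewrite EFinM.
  rewrite integralZl// EFinM /osc_kernel /Rintegral fineK//.
  exact: integrable_fin_num.
have ih : (mu \x mu)%E.-integrable setT (EFin \o h).
  apply/integrable12ltyP; first exact/measurable_EFinP.
  apply: (@le_lt_trans _ _ (\int[mu]_x (`|f x| * (be - al))%:E)%E); last first.
    have /integrableP[_] : mu.-integrable setT (fun x => (`|f x| * (be - al))%:E).
      under eq_fun do rewrite EFinM.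
      by apply: (integrableZr measurableT _ (integrable_norm fi)).
    apply: le_lt_trans; rewrite le_eqVlt; apply/orP; left; apply/eqP.
    by apply: eq_integral => x _; rewrite gee0_abs// lee_fin mulr_ge0// subr_ge0.
  apply: ge0_le_integral => //.
  - by move=> x _; apply: integral_ge0.
  - exact: (@measurable_fun_fubini_tonelli_F _ _ _ _ _ mu _ mabs (fun=> abse_ge0 _)).
  - apply/measurable_EFinP; apply: measurable_funM => //; exact: measurableT_comp.
  - move=> x _.
    apply: (@le_trans _ _ (\int[mu]_xi (`|f x| * \1_(`[al, be]) xi)%:E)%E).
      apply: ge0_le_integral => //.
      + apply: measurableT_comp => //; apply/measurable_EFinP.
        exact: measurableT_comp mh _.
      + apply/measurable_EFinP; apply: measurable_funM => //.
      + by move=> xi _; rewrite lee_fin; exact: hle.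
    under eq_integral do rewrite EFinM.
    rewrite integralZl//; last exact: (integrable_indic_itv al be true false).
    rewrite integral_indic//= setIT lebesgue_measure_itv/= lte_fin.
    case: ifPn => _; first by rewrite -EFinB -EFinM.
    by rewrite mule0 lee_fin mulr_ge0// subr_ge0.
transitivity (fine (\int[mu]_x \int[mu]_xi (h (x, xi))%:E)%E).
  by rewrite /Rintegral; congr fine; apply: eq_integral => x _; rewrite inner.
have -> := Fubini ih.
rewrite Rintegral_mkcond /Rintegral; congr fine; apply: eq_integral => xi _ /=.
rewrite patchE /h /= indicE; case: ifPn => _; last first.
  by under eq_integral do rewrite mulr0; rewrite integral0.
under eq_integral do rewrite mulr1.
rewrite /osc_transform /Rintegral fineK//.
exact: (integrable_fin_num measurableT (L1_osc_scaled xi fi)).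
Qed.
End OscillatoryKernels.

(** * Fourier transforms in L^2 through their integrals over intervals *)
Section WeakFourier.
Context {R : realType}.
Local Notation mu := (@lebesgue_measure R).
Local Notation L1 f := (mu.-integrable setT (EFin \o f)).
Implicit Types (f g k A B : R -> R) (x al be xi : R).

Lemma Rintegral_dominated_cvg (F : nat -> R -> R) f g :
  (forall n, measurable_fun setT (F n)) ->
  (forall x, F n x @[n --> \oo] --> f x) -> L1 g ->
  (forall n x, `|F n x| <= g x) ->
  L1 f /\ (\int[mu]_x F n x) @[n --> \oo] --> \int[mu]_x f x.
Proof.
move=> mF Ff gi Fg.
have mf : measurable_fun setT f.
  by apply: (@measurable_fun_cvg _ _ _ _ F f mF) => x _; exact: Ff.
have [] := @dominated_convergence _ _ _ mu setT measurableT
  (fun n => EFin \o F n) (EFin \o f) (EFin \o g).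
- by move=> n; apply/measurable_EFinP; exact: mF.
- by apply/measurable_EFinP; exact: mf.
- by apply: aeW => x _ /=; apply/cvg_EFin; [exact: nearW|exact: Ff].
- exact: gi.
- by apply: aeW => x n _ /=; rewrite lee_fin.
move=> fi _ cF; split; first exact: fi.
apply: fine_cvg; rewrite /Rintegral fineK//; exact: integrable_fin_num.
Qed.

Lemma cvg0e_lt T (F : set_system T) {FF : Filter F} (v : T -> \bar R) (e : R) :
  v x @[x --> F] --> (0 : \bar R) -> 0 < e -> \forall x \near F, (v x < e%:E)%E.
Proof.
move=> /fine_cvgP[vfin /cvgr0_norm_lt v0] e0.
near=> x.
have vx : v x \is a fin_num by near: x.
rewrite -(fineK vx) lte_fin (le_lt_trans (ler_norm _))//.
by near: x; exact: v0.
Unshelve. all: by end_near. Qed.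

Lemma cvg_truncation f x :
  (f \_ `[- n%:R, n%:R]) x @[n --> \oo] --> f x.
Proof.
apply: cvg_near_cst; near=> n.
rewrite patchE mem_set//= in_itv/= -ler_norml.
by near: n; exact: nbhs_infty_ger.
Unshelve. all: by end_near. Qed.

Lemma truncation_le f (D : set R) x : `|(f \_ D) x| <= `|f x|.
Proof. by rewrite patchE; case: ifPn => //; rewrite normr0. Qed.

Lemma inL2_indic al be : al <= be -> inL2 (\1_(`[al, be]%classic) : R -> R).
Proof.
move=> ab; apply: sqr_inL2; first exact: measurable_indic.
rewrite (_ : (fun x => _) = \1_(`[al, be]%classic)); last first.
  by apply/funext => x; rewrite indicE; case: (_ \in _); rewrite ?expr1n ?expr0n.
exact: (integrable_indic_itv al be true false).
Qed.

Lemma truncation_L1 f al be : al <= be -> inL2 f -> L1 (f \_ `[al, be]).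
Proof.
move=> ab f2.
rewrite (_ : f \_ _ = fun x => f x * \1_(`[al, be]%classic) x); last first.
  by apply/funext => x; rewrite patchE indicE; case: ifPn; rewrite ?mulr1 ?mulr0.
by apply: inL2_integrableM => //; exact: inL2_indic.
Qed.

Lemma Rintegral_itv_indic f al be :
  \int[mu]_(x in `[al, be]) f x = \int[mu]_x (f x * \1_(`[al, be]%classic) x).
Proof.
rewrite Rintegral_mkcond; apply: eq_Rintegral => x _.
by rewrite patchE indicE; case: ifPn; rewrite ?mulr1 ?mulr0.
Qed.

Lemma inL2_integrable_itv f al be : al <= be -> inL2 f ->
  mu.-integrable `[al, be] (EFin \o f).
Proof.
move=> ab f2; apply/integrable_mkcond => //.
by rewrite restrict_EFin; exact: truncation_L1.
Qed.

(** Both sides are limits of the same quantity for the truncations of [f],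
    for which the identity is [fubini_osc]: the left one by dominated
    convergence, the right one because L^2 convergence implies convergence of
    integrals over bounded intervals. *)
Lemma fourierL2_kernel f h k al be : oscillating k -> al <= be ->
  inL2 f -> inL2 h ->
  L2norm (fun xi => osc_transform k (f \_ `[- n%:R, n%:R]) xi - h xi)
    @[n --> \oo] --> (0 : \bar R) ->
  \int[mu]_x (f x * osc_kernel k al be x) = \int[mu]_(xi in `[al, be]) h xi.
Proof.
move=> osck ab f2 h2 cvg0.
pose F n := f \_ `[- n%:R, n%:R].
have F1 n : L1 (F n) by apply: truncation_L1 => //; rewrite (@le_trans _ _ 0)// oppr_le0.
have K2 := inL2_osc_kernel osck ab.
have c1 : (\int[mu]_x (F n x * osc_kernel k al be x)) @[n --> \oo] -->
    \int[mu]_x (f x * osc_kernel k al be x).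
  apply: (Rintegral_dominated_cvg _ _
    (g := fun x => `|f x * osc_kernel k al be x|) _ _).2.
  - by move=> n; apply: measurable_funM; [exact: L1_measurable|exact: inL2_measurable].
  - by move=> x; apply: cvgMr_tmp; exact: cvg_truncation.
  - exact: (integrable_norm (inL2_integrableM f2 K2)).
  - by move=> n x; rewrite !normrM ler_wpM2r//; exact: truncation_le.
have c2 : (\int[mu]_x (F n x * osc_kernel k al be x)) @[n --> \oo] -->
    \int[mu]_(xi in `[al, be]) h xi.
  apply/cvgrPdist_lt => e e0.
  have C0 : 0 <= fine (L2norm (\1_(`[al, be]%classic) : R -> R)).
    by rewrite fine_ge0// Lnorm_ge0.
  set C := fine _ in C0.
  have e'0 : 0 < e / (1 + C) by rewrite divr_gt0// ltr_pwDl.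
  have small : (\forall n \near \oo, (L2norm (fun xi => (osc_transform k (F n) xi - h xi)%R) < (e / (1 + C))%:E)%E).
    exact: cvg0e_lt.
  near=> n.
  have nlt : (L2norm (fun xi => (osc_transform k (F n) xi - h xi)%R)
              < (e / (1 + C))%:E)%E by near: n.
  have d2 : inL2 (fun xi => osc_transform k (F n) xi - h xi).
    rewrite /inL2 inE; apply/andP; split; apply/mem_set => /=; last first.
      exact: lt_trans nlt (ltry _).
    apply: measurable_funB; last exact: inL2_measurable.
    by apply: continuous_measurable_fun; apply: continuous_osc_transform.
  rewrite fubini_osc// distrC -RintegralB//; first last.
  - exact: inL2_integrable_itv.
  - by apply: integrable_itv_continuous; exact: continuous_osc_transform.
  rewrite Rintegral_itv_indic.
  rewrite -lte_fin (le_lt_trans (cauchy_schwarz d2 (inL2_indic ab)))//.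
  have Cfin : L2norm (\1_(`[al, be]%classic) : R -> R) = C%:E.
    by rewrite /C fineK// ge0_fin_numE ?Lnorm_ge0//; exact/inL2_lty/inL2_indic.
  rewrite Cfin (@le_lt_trans _ _ ((e / (1 + C))%:E * C%:E)%E)//.
    by rewrite lee_wpmul2r// ltW.
  rewrite -EFinM lte_fin mulrAC ltr_pdivrMr ?ltr_pwDl//.
  by rewrite ltr_pM2l// ltrDr.
exact: (cvg_unique _ c1 c2).
Unshelve. all: by end_near. Qed.
End WeakFourier.

(** Lets the filter lemmas apply to statements that hold almost everywhere for
    the Lebesgue measure. *)
#[local] Instance lebesgue_ae_filter (R : realType) :
  Filter (nbhs (almost_everywhere (@lebesgue_measure R))) :=
  ae_filter_ringOfSetsType (@lebesgue_measure R).

Section WeakFourierTheory.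
Context {R : realType}.
Local Notation mu := (@lebesgue_measure R).
Local Notation L1 f := (mu.-integrable setT (EFin \o f)).
Implicit Types (f g k A B : R -> R) (x al be xi : R).

Definition interval_integrable A := measurable_fun setT A /\
  forall al be, mu.-integrable `[al, be] (EFin \o A).

Lemma continuous_interval_integrable A : continuous A -> interval_integrable A.
Proof.
move=> cA; split; first exact: continuous_measurable_fun.
by move=> al be; exact: integrable_itv_continuous.
Qed.

Lemma inL2_interval_integrable A : inL2 A -> interval_integrable A.
Proof.
move=> A2; split; first exact: inL2_measurable.
move=> al be; have [ab|ba] := leP al be; first exact: inL2_integrable_itv.
by rewrite set_itv_ge ?bnd_simp -?ltNge//; exact: integrable_set0.
Qed.

Lemma interval_integrable_le A B : measurable_fun setT A ->
  (forall xi, `|A xi| <= B xi) -> interval_integrable B -> interval_integrable A.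
Proof.
move=> mA AB [mB iB]; split => // al be.
apply: (le_integrable _ _ _ (iB al be)) => //.
  by apply/measurable_EFinP; apply: measurable_funTS.
by move=> x _ /=; rewrite lee_fin (le_trans (AB x))// ler_norm.
Qed.

Lemma interval_integrableD A B : interval_integrable A -> interval_integrable B ->
  interval_integrable (fun xi => A xi + B xi).
Proof.
move=> [mA iA] [mB iB]; split; first exact: measurable_funD.
by move=> al be; apply: (integrableD _ (iA al be) (iB al be)).
Qed.

Lemma interval_integrable_norm A : interval_integrable A ->
  interval_integrable (fun xi => `|A xi|).
Proof.
move=> [mA iA]; split; first exact: measurableT_comp.
by move=> al be; exact: (integrable_norm (iA al be)).
Qed.

Lemma interval_integrableB A B : interval_integrable A -> interval_integrable B ->
  interval_integrable (fun xi => A xi - B xi).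
Proof.
move=> [mA iA] [mB iB]; split; first exact: measurable_funB.
by move=> al be; apply: (integrableB _ (iA al be) (iB al be)).
Qed.

Lemma interval_integrable_locally A : interval_integrable A ->
  locally_integrable setT A.
Proof.
move=> [mA iA]; split => //; first exact: openT.
move=> K _ cK; have [M [_ KM]] := compact_bounded cK.
have {}KM : K `<=` `[- (`|M| + 1), `|M| + 1].
  move=> x Kx; rewrite /= in_itv/= -ler_norml.
  by apply: KM Kx; rewrite ltr_pwDr// ler_norm.
have /integrableP[_] := iA (- (`|M| + 1)) (`|M| + 1).
apply: le_lt_trans; apply: ge0_subset_integral => //.
- exact: compact_measurable.
- by apply/measurable_EFinP; apply: measurableT_comp => //; exact: measurable_funTS.
Qed.

(** Lebesgue differentiation of the primitives from 0. *)
Lemma eq_integrals_ae A B : interval_integrable A -> interval_integrable B ->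
  (forall be, 0 <= be ->
    \int[mu]_(xi in `[0, be]) A xi = \int[mu]_(xi in `[0, be]) B xi) ->
  {ae mu, forall xi, 0 <= xi -> A xi = B xi}.
Proof.
move=> iA iB AB; pose f xi := A xi - B xi.
have iF : interval_integrable f by exact: interval_integrableB.
have ne0 : {ae mu, forall xi : R, xi <> 0}.
  exists [set 0]; split; [exact: measurable_set1|exact: lebesgue_measure_set1|].
  by move=> xi /= /contrapT.
have := @FTC1 R f (BLeft 0) (fun y => iF.2 0 y) (interval_integrable_locally iF).
apply: filterS2 ne0 => xi /eqP xin0 /= dxi xi0; have [|_] := dxi.
  by rewrite lte_fin lt_neqAle eq_sym xin0.
rewrite (_ : (fun x => _) = cst 0); last first.
  apply/funext => y /=; have [y0|y0] := leP 0 y.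
    rewrite RintegralB//; [|exact: iA.2|exact: iB.2].
    by rewrite AB// subrr.
  by rewrite set_itv_ge ?Rintegral_set0// bnd_simp -ltNge.
by rewrite derive1_cst => /esym/eqP; rewrite subr_eq0 => /eqP.
Qed.

(** [A + i B] plays the role of the Fourier transform of the real function [f]
    at nonnegative frequencies; the negative ones follow by conjugation. The sign in the last clause
    is that of [exp (- i xi x)]. This is the only form in which transforms of
    L^2 functions are used: it is stable under changes on null sets, under
    differences and under the propagator, and it determines [A] and [B] almost
    everywhere. *)
Definition weak_fourier f A B :=
  [/\ interval_integrable A, interval_integrable B,
    forall al be, 0 <= al <= be ->
      \int[mu]_x (f x * osc_kernel cos al be x) = \int[mu]_(xi in `[al, be]) A xi &
    forall al be, 0 <= al <= be ->
      \int[mu]_x (f x * osc_kernel sin al be x) = - \int[mu]_(xi in `[al, be]) B xi].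

Lemma weak_fourier_unique f A B A' B' :
  weak_fourier f A B -> weak_fourier f A' B' ->
  {ae mu, forall xi, 0 <= xi -> A xi = A' xi /\ B xi = B' xi}.
Proof.
move=> [iA iB fA fB] [iA' iB' fA' fB'].
have AA : {ae mu, forall xi, 0 <= xi -> A xi = A' xi}.
  apply: eq_integrals_ae => // be be0; have b : 0 <= (0 : R) <= be by rewrite lexx.
  by rewrite -fA// fA'.
have BB : {ae mu, forall xi, 0 <= xi -> B xi = B' xi}.
  apply: eq_integrals_ae => // be be0; have b : 0 <= (0 : R) <= be by rewrite lexx.
  by apply: oppr_inj; rewrite -fB// fB'.
by apply: filterS2 AA BB => xi + + xi0 => /(_ xi0) -> /(_ xi0) ->.
Qed.

Lemma ae_eq_itv_Rintegral A B al be :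
  interval_integrable A -> interval_integrable B -> 0 <= al ->
  {ae mu, forall xi, 0 <= xi -> A xi = B xi} ->
  \int[mu]_(xi in `[al, be]) A xi = \int[mu]_(xi in `[al, be]) B xi.
Proof.
move=> iA iB al0 AB; congr fine; apply: ae_eq_integral => //.
- exact: measurable_int (iA.2 al be).
- exact: measurable_int (iB.2 al be).
- apply: filterS AB => xi + /=; rewrite in_itv/= => + /andP[axi _].
  by move=> /(_ (le_trans al0 axi)) ->.
Qed.

Lemma weak_fourier_ae f A B A' B' : weak_fourier f A B ->
  interval_integrable A' -> interval_integrable B' ->
  {ae mu, forall xi, 0 <= xi -> A xi = A' xi /\ B xi = B' xi} ->
  weak_fourier f A' B'.
Proof.
move=> [iA iB fA fB] iA' iB' AB.
have AA : {ae mu, forall xi, 0 <= xi -> A xi = A' xi}.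
  by apply: filterS AB => xi + xi0 => /(_ xi0)[].
have BB : {ae mu, forall xi, 0 <= xi -> B xi = B' xi}.
  by apply: filterS AB => xi + xi0 => /(_ xi0)[].
split => // al be /andP[al0 ab].
  by rewrite fA ?al0//; exact: ae_eq_itv_Rintegral.
by rewrite fB ?al0//; congr (- _); exact: ae_eq_itv_Rintegral.
Qed.

Lemma weak_fourier_L1 f : L1 f ->
  weak_fourier f (osc_transform cos f) (fun xi => - osc_transform sin f xi).
Proof.
move=> fi.
have cc := continuous_osc_transform oscillating_cos fi.
have cs := continuous_osc_transform oscillating_sin fi.
split.
- exact: continuous_interval_integrable.
- by apply: continuous_interval_integrable => xi; apply: cvgN; exact: cs.
- by move=> al be /andP[_ ab]; apply: fubini_osc => //; exact: oscillating_cos.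
- move=> al be /andP[_ ab]; rewrite fubini_osc//; last exact: oscillating_sin.
  under [in RHS]eq_Rintegral do rewrite -mulN1r.
  rewrite RintegralZl//; first by rewrite mulN1r opprK.
  exact: integrable_itv_continuous.
Qed.

(** Passes from the L^2 convergence of complex transforms to that of their real
    and imaginary parts. *)
Lemma L2normC_squeeze (G : nat -> R -> R[i]) (h : nat -> R -> R) :
  (forall n, measurable_fun setT (fun xi => complex.Re (G n xi))) ->
  (forall n, measurable_fun setT (fun xi => complex.Im (G n xi))) ->
  (forall n, measurable_fun setT (h n)) ->
  (forall n xi, h n xi ^+ 2 <= complex.Re (G n xi) ^+ 2 + complex.Im (G n xi) ^+ 2) ->
  L2normC (G n) @[n --> \oo] --> (0 : \bar R) ->
  L2norm (h n) @[n --> \oo] --> (0 : \bar R).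
Proof.
move=> mRe mIm mh hG; apply: squeeze_cvge (cvg_cst _) => //.
apply: nearW => n; rewrite Lnorm_ge0/=; apply: L2norm_le => //.
  rewrite (_ : (fun x => _) =
    (fun x => Num.sqrt (complex.Re (G n x) ^+ 2 + complex.Im (G n x) ^+ 2))).
    have msqrt : measurable_fun setT (@Num.sqrt R).
      by apply: continuous_measurable_fun; exact: sqrt_continuous.
    apply: (measurableT_comp msqrt).
    by apply: measurable_funD; exact: measurable_funX.
  by apply/funext => x; case: (G n x).
move=> x; rewrite (ger0_norm (_ : 0 <= Normc.normc _)) ?sqrtr_ge0//.
  by rewrite -sqrtr_sqr; move: (hG n x); case: (G n x) => p q /=; exact: ler_wsqrtr.
by case: (G n x) => p q; exact: sqrtr_ge0.
Qed.

Lemma weak_fourierL2 f (g : R -> R[i]) : is_fourierL2 f g ->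
  weak_fourier f (fun xi => complex.Re (g xi)) (fun xi => complex.Im (g xi)).
Proof.
move=> [f2 [Re2 Im2] cvg0].
have F1 n : L1 (f \_ `[- n%:R, n%:R]).
  by apply: truncation_L1 => //; rewrite (@le_trans _ _ 0)// oppr_le0.
have mosc k n : oscillating k ->
    measurable_fun setT (osc_transform k (f \_ `[- n%:R, n%:R])).
  by move=> osck; apply: continuous_measurable_fun; exact: continuous_osc_transform.
have mcos n := mosc cos n oscillating_cos.
have msin n := mosc sin n oscillating_sin.
have ReE n xi : complex.Re (fourier (f \_ `[- n%:R, n%:R]) xi - g xi) =
    osc_transform cos (f \_ `[- n%:R, n%:R]) xi - complex.Re (g xi).
  by case: (g xi).
have ImE n xi : complex.Im (fourier (f \_ `[- n%:R, n%:R]) xi - g xi) =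
    - (osc_transform sin (f \_ `[- n%:R, n%:R]) xi + complex.Im (g xi)).
  by case: (g xi) => p q /=; rewrite opprD.
have mRe n : measurable_fun setT (fun xi =>
    complex.Re (fourier (f \_ `[- n%:R, n%:R]) xi - g xi)).
  under eq_fun do rewrite ReE; apply: measurable_funB => //; exact: inL2_measurable.
have mIm n : measurable_fun setT (fun xi =>
    complex.Im (fourier (f \_ `[- n%:R, n%:R]) xi - g xi)).
  under eq_fun do rewrite ImE; apply: measurableT_comp => //.
  by apply: measurable_funD => //; exact: inL2_measurable.
split; [exact: inL2_interval_integrable|exact: inL2_interval_integrable| |].
- move=> al be /andP[_ ab]; apply: fourierL2_kernel => //; first exact: oscillating_cos.
  apply: L2normC_squeeze cvg0 => // n.
    by apply: measurable_funB => //; exact: inL2_measurable.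
  by move=> xi; rewrite ReE lerDl sqr_ge0.
- move=> al be /andP[_ ab].
  rewrite (@fourierL2_kernel _ _ (fun xi => - complex.Im (g xi)))//.
  + under eq_Rintegral do rewrite -mulN1r.
    by rewrite RintegralZl ?mulN1r//; exact: (inL2_interval_integrable Im2).2.
  + exact: oscillating_sin.
  + by rewrite (_ : (fun xi => _) = (fun xi => -1 * complex.Im (g xi)));
      [exact: inL2Z|apply/funext => xi; rewrite mulN1r].
  apply: L2normC_squeeze cvg0 => // n.
    apply: measurable_funB => //; apply: measurableT_comp => //.
    exact: inL2_measurable.
  by move=> xi; rewrite ImE opprK sqrrN lerDr sqr_ge0.
Qed.

End WeakFourierTheory.

(** * Cutoff functions *)
Section WeakDerivative.
Context {R : realType}.
Local Notation mu := (@lebesgue_measure R).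
Local Notation L1 f := (mu.-integrable setT (EFin \o f)).
Implicit Types (f g k q v : R -> R) (x y al be xi : R) (n : nat).

(** Lets [max(0, y)^2] be differentiated at the corner [y = 0] together with the
    other points. *)
Lemma is_derive_quadratic_remainder f y d (C : R) :
  (forall h, `|f (y + h) - f y - h * d| <= C * h ^+ 2) -> is_derive y 1 f d.
Proof.
move=> fC; have C0 : 0 <= C.
  by have := fC 1; rewrite expr1n mulr1; apply: le_trans.
suff H : h^-1 *: (f (h *: 1 + y) - f y) @[h --> 0^'] --> d.
  by apply: DeriveDef; [apply/cvg_ex; exists d|apply/cvg_lim].
apply/cvgrPdist_le => e e0; near=> h.
have h0 : h != 0 by near: h; exact: nbhs_dnbhs_neq.
have hn : 0 < `|h| by rewrite normr_gt0.
rewrite /GRing.scale/= mulr1 [h + y]addrC.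
have -> : d - h^-1 * (f (y + h) - f y) = - (h^-1 * (f (y + h) - f y - h * d)).
  by rewrite [in RHS]mulrBr mulKf// opprB.
rewrite normrN normrM normfV ler_pdivrMl// (le_trans (fC h))//.
rewrite -[h ^+ 2]real_normK ?num_real// expr2 mulrCA ler_wpM2l//.
have : `|h| <= e / (1 + C).
  near: h; apply: dnbhs0_le; rewrite divr_gt0// ltr_pwDl//.
rewrite ler_pdivlMr ?ltr_pwDl// => /(le_trans _); apply.
by rewrite mulrC ler_wpM2l// lerDr.
Unshelve. all: by end_near. Qed.

(** The square makes this C^1 at [y = 1] and [y = -1], which is all that
    [test_function] asks for. *)
Definition bump y : R := (Num.max 0 (1 - y ^+ 2)) ^+ 2.
Definition cutoff n x := bump (x / n.+1%:R).
Definition cutoff' n x :=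
  - (4 * (x / n.+1%:R) * Num.max 0 (1 - (x / n.+1%:R) ^+ 2) / n.+1%:R).

Lemma is_derive_sqr_pos y :
  is_derive y 1 (fun z : R => (Num.max 0 z) ^+ 2) (2 * Num.max 0 y).
Proof.
apply: (@is_derive_quadratic_remainder _ _ _ 1) => h; rewrite mul1r ler_norml.
by rewrite /Num.max; case: ifPn => a1; case: ifPn => a2;
  rewrite ?mulr0 -?leNgt in a1 a2 *; apply/andP; split; nra.
Qed.

Lemma is_derive_cutoff n x : is_derive x 1 (cutoff n) (cutoff' n x).
Proof.
have dz : is_derive x 1 (fun z : R => 1 - (z / n.+1%:R) ^+ 2) (- (2 * (x / n.+1%:R) / n.+1%:R)).
  by apply: is_derive_eq; rewrite /GRing.scale/= !mulr0; ring.
have := @is_derive1_comp R _ _ x _ _ (is_derive_sqr_pos _) dz.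
rewrite /cutoff/bump => dc; apply: is_derive_eq dc _.
by rewrite /cutoff'; ring.
Qed.

Lemma continuous_max0 : continuous (fun y : R => Num.max 0 y).
Proof. by move=> y; apply: continuous_max; [exact: cvg_cst|exact: cvg_id]. Qed.

Lemma continuous_ratio n : continuous (fun x : R => x / n.+1%:R).
Proof. by move=> x; apply: cvgMr_tmp; exact: cvg_id. Qed.

Lemma continuous_cutoff n : continuous (cutoff n).
Proof.
move=> x; apply: differentiable_continuous; apply/derivable1_diffP.
by case: (is_derive_cutoff n x).
Qed.

Lemma continuous_cutoff' n : continuous (cutoff' n).
Proof.
move=> x; apply: cvgN; apply: cvgMr_tmp; apply: cvgM.
  by apply: cvgMl_tmp; exact: continuous_ratio.
apply: (@continuous_comp _ _ _ (fun x => 1 - (x / n.+1%:R) ^+ 2) (fun y : R => Num.max 0 y)); last exact: continuous_max0.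
apply: cvgB; first exact: cvg_cst.
apply: (@continuous_comp _ _ _ (fun x : R => x / n.+1%:R) (fun y => y ^+ 2)).
  exact: continuous_ratio.
exact: exprn_continuous.
Qed.

Lemma cutoff_ge0 n x : 0 <= cutoff n x.
Proof. exact: sqr_ge0. Qed.

Lemma cutoff_le1 n x : cutoff n x <= 1.
Proof.
rewrite /cutoff /bump exprn_ile1// ?le_max ?lexx//.
by rewrite ge_max ler01 gerBl sqr_ge0.
Qed.

Lemma cutoff_norm_le1 n x : `|cutoff n x| <= 1.
Proof. by rewrite ger0_norm ?cutoff_ge0// cutoff_le1. Qed.

Lemma cutoff_eq0 n x : n.+1%:R < `|x| -> cutoff n x = 0.
Proof.
move=> nx; rewrite /cutoff /bump max_l ?expr0n//.
rewrite subr_le0 -real_normK ?num_real// exprn_ege1// normrM normfV.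
by rewrite (gtr0_norm (_ : 0 < n.+1%:R :> R))// ler_pdivlMr// mul1r ltW.
Qed.

(** The decay in [n] makes the term in which the derivative falls on the
    cutoff disappear in the limit. *)
Lemma cutoff'_le n x : `|cutoff' n x| <= 4 / n.+1%:R.
Proof.
rewrite normrN normrM normfV (gtr0_norm (_ : 0 < n.+1%:R :> R))//.
rewrite ler_wpM2r ?invr_ge0//; set y := x / _.
rewrite ler_norml /Num.max; case: ifPn => [y1|_]; last by rewrite mulr0; lra.
have ya : -1 <= y by nra.
have yb : y <= 1 by nra.
have := sqr_ge0 y; set m := y ^+ 2 in y1 * => m0.
by apply/andP; split; nra.
Qed.

Lemma cvg_cutoff x : cutoff n x @[n --> \oo] --> (1 : R).
Proof.
have -> : (1 : R) = bump (x * 0).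
  by rewrite /bump mulr0 expr0n/= subr0 max_r ?expr1n.
have cb : continuous bump.
  move=> y; apply: (@continuous_comp _ _ _ (fun y : R => Num.max 0 (1 - y ^+ 2)) (fun y => y ^+ 2)); last exact: exprn_continuous.
  apply: (@continuous_comp _ _ _ (fun y : R => 1 - y ^+ 2) (fun y => Num.max 0 y)); last exact: continuous_max0.
  by apply: cvgB; [exact: cvg_cst|exact: exprn_continuous].
apply: (@cvg_comp _ _ _ (fun n => x / n.+1%:R) bump); last exact: cb.
by apply: cvgMl_tmp; exact: cvg_harmonic.
Qed.

Lemma inL2_cutoff n : inL2 (cutoff n).
Proof.
apply: (@inL2_le _ _ (\1_(`[- n.+1%:R, n.+1%:R]%classic) : R -> R)).
- by apply: continuous_measurable_fun; exact: continuous_cutoff.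
- move=> x; rewrite indicE; have [xn|xn] := leP `|x| n.+1%:R.
    rewrite mem_set/= ?normr1; last by rewrite in_itv/= -ler_norml.
    exact: cutoff_norm_le1.
  by rewrite cutoff_eq0// normr0.
- by apply: inL2_indic; rewrite (@le_trans _ _ 0)// oppr_le0.
Qed.

Lemma test_function_cutoff n k k' xi : continuous k -> continuous k' ->
  (forall y, is_derive y 1 k (k' y)) ->
  let psi x := cutoff n x * k (xi * x) in
  test_function psi /\
  derive1 psi = fun x => cutoff' n x * k (xi * x) + xi * (cutoff n x * k' (xi * x)).
Proof.
move=> ck ck' dk psi.
have dpsi x : is_derive x 1 psi (cutoff' n x * k (xi * x) + xi * (cutoff n x * k' (xi * x))).
  have dm : is_derive x 1 (fun y : R => xi * y) xi.
    by apply: is_derive_eq; rewrite /GRing.scale/= mulr1.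
  have dc := @is_derive1_comp R k (fun y => xi * y) x _ _ (dk _) dm.
  have dn := is_derive_cutoff n x.
  rewrite /psi (_ : (fun _ => _) = cutoff n * (k \o (fun y => xi * y)))//.
  by apply: is_derive_eq; rewrite /GRing.scale/=; ring.
have dE : derive1 psi = fun x => cutoff' n x * k (xi * x) + xi * (cutoff n x * k' (xi * x)).
  by apply/funext => x; rewrite derive1E; exact: derive_val.
have cs (l : R -> R) : continuous l -> continuous (fun x => l (xi * x)).
  move=> cl x; apply: (@continuous_comp _ _ _ (fun y => xi * y) l); last exact: cl.
  by apply: cvgMl_tmp; exact: cvg_id.
split => //; split.
- by move=> x; exact: ex_derive.
- rewrite dE => x; apply: cvgD.
    by apply: cvgM; [exact: continuous_cutoff'|exact: cs].
  by apply: cvgMl_tmp; apply: cvgM; [exact: continuous_cutoff|exact: cs].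
- by exists n.+1%:R => x nx; rewrite /psi cutoff_eq0// mul0r.
Qed.

End WeakDerivative.

(** * Fourier transform of a weak derivative *)
Section FourierOfWeakDerivative.
Context {R : realType}.
Local Notation mu := (@lebesgue_measure R).
Local Notation L1 f := (mu.-integrable setT (EFin \o f)).
Implicit Types (f g k q v : R -> R) (x y al be xi : R) (n : nat).

Lemma L1_cutoff f n : L1 f -> L1 (fun x => f x * cutoff n x).
Proof.
move=> fi; apply: L1_osc => //; first by apply: continuous_measurable_fun; exact: continuous_cutoff.
by move=> x; exact: cutoff_norm_le1.
Qed.

Lemma L1_cutoff' f n : L1 f -> L1 (fun x => f x * cutoff' n x).
Proof.
move=> fi; apply: (@L1_le _ _ (fun x => 4 / n.+1%:R * `|f x|)).
- apply: measurable_funM; first exact: L1_measurable.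
  by apply: continuous_measurable_fun; exact: continuous_cutoff'.
- by apply: (integrableZl measurableT _ (integrable_norm fi)).
- by move=> x; rewrite normrM mulrC ler_wpM2r// cutoff'_le.
Qed.

(** The definition of the weak derivative, tested against
    [cutoff n x * k (xi x)]. *)
Lemma osc_transform_cutoff q v k k' xi n :
  is_weak_derivative q v -> L1 q -> inL2 v ->
  oscillating k -> oscillating k' -> (forall y, is_derive y 1 k (k' y)) ->
  osc_transform k (fun x => v x * cutoff n x) xi =
  - (osc_transform k (fun x => q x * cutoff' n x) xi +
     xi * osc_transform k' (fun x => q x * cutoff n x) xi).
Proof.
move=> [_ _ ibp] q1 v2 osck osck' dk.
have [ck k1 _] := osck; have [ck' k1' _] := osck'.
have [tpsi dpsi] := test_function_cutoff n xi ck ck' dk.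
have := ibp _ tpsi; rewrite dpsi => E; apply: oppr_inj; rewrite opprK.
have -> : osc_transform k (fun x => v x * cutoff n x) xi =
    \int[mu]_x (v x * (cutoff n x * k (xi * x))).
  by apply: eq_Rintegral => x _; rewrite mulrA.
rewrite -E /osc_transform -RintegralZl//; last first.
  by apply: L1_osc_scaled => //; exact: L1_cutoff.
rewrite -RintegralD//.
- by apply: eq_Rintegral => x _; ring.
- by apply: L1_osc_scaled => //; exact: L1_cutoff'.
- by apply: L1Z; apply: L1_osc_scaled => //; exact: L1_cutoff.
Qed.

Lemma osc_transformB k f g xi : oscillating k -> L1 f -> L1 g ->
  osc_transform k f xi - osc_transform k g xi =
  osc_transform k (fun x => f x - g x) xi.
Proof.
move=> osck fi gi; rewrite /osc_transform -RintegralB//.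
- by apply: eq_Rintegral => x _; rewrite mulrBl.
- exact: L1_osc_scaled.
- exact: L1_osc_scaled.
Qed.

(** The derivative [v] is only in L^2, so [k (xi x)] is no test function for it,
    even after integration in [xi]. The cutoff is removed by letting [n] tend to
    infinity: on the side of [v] the kernel is in L^2 and dominated convergence
    applies, on the side of [q], which is in L^1, convergence is uniform for
    [xi] in the interval. *)
Lemma weak_derivative_kernel q v k k' al be : 0 <= al <= be ->
  is_weak_derivative q v -> L1 q -> inL2 v ->
  oscillating k -> oscillating k' -> (forall y, is_derive y 1 k (k' y)) ->
  \int[mu]_x (v x * osc_kernel k al be x) =
  - \int[mu]_(xi in `[al, be]) (xi * osc_transform k' q xi).
Proof.
move=> /andP[al0 ab] qv q1 v2 osck osck' dk.
have K2 := inL2_osc_kernel osck ab.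
have v1 n : L1 (fun x => v x * cutoff n x).
  by apply: inL2_integrableM => //; exact: inL2_cutoff.
pose h n xi := - (osc_transform k (fun x => q x * cutoff' n x) xi +
     xi * osc_transform k' (fun x => q x * cutoff n x) xi).
have hE n : \int[mu]_x (v x * cutoff n x * osc_kernel k al be x) =
    \int[mu]_(xi in `[al, be]) h n xi.
  rewrite fubini_osc//; apply: eq_Rintegral => xi _.
  exact: osc_transform_cutoff.
have c1 : (\int[mu]_x (v x * cutoff n x * osc_kernel k al be x)) @[n --> \oo] -->
    \int[mu]_x (v x * osc_kernel k al be x).
  apply: (Rintegral_dominated_cvg _ _
    (g := fun x => `|v x * osc_kernel k al be x|) _ _).2.
  - move=> n; apply: measurable_funM; last exact: inL2_measurable.
    exact: L1_measurable.
  - move=> x; apply: cvgMr_tmp; rewrite -[X in _ --> X]mulr1.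
    by apply: cvgMl_tmp; exact: cvg_cutoff.
  - exact: (integrable_norm (inL2_integrableM v2 K2)).
  - move=> n x; rewrite normrM [leRHS]normrM ler_wpM2r//.
    by rewrite normrM ler_piMr// cutoff_norm_le1.
have cq : (\int[mu]_x `|q x - q x * cutoff n x|) @[n --> \oo] --> (0 : R).
  rewrite -[X in _ --> X](_ : \int[mu]_x (cst 0 x) = 0); last first.
    by rewrite Rintegral_cst//= mul0r.
  apply: (Rintegral_dominated_cvg _ _ (g := fun x => `|q x|) _ _).2.
  - move=> n; apply: measurableT_comp => //; apply: measurable_funB.
      exact: L1_measurable.
    exact: (L1_measurable (L1_cutoff n q1)).
  - move=> x; rewrite /= -[X in _ --> X](normr0 R) -(subrr (q x)).
    apply: cvg_norm; apply: cvgB; first exact: cvg_cst.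
    rewrite -[X in _ --> X]mulr1; apply: cvgMl_tmp; exact: cvg_cutoff.
  - exact: (integrable_norm q1).
  - move=> n x; rewrite normr_id.
    have -> : q x - q x * cutoff n x = q x * (1 - cutoff n x) by ring.
    rewrite normrM ler_piMr//.
    by rewrite ger0_norm ?subr_ge0 ?cutoff_le1// gerBl cutoff_ge0.
pose Q := \int[mu]_x `|q x|.
have c2 : (\int[mu]_(xi in `[al, be]) h n xi) @[n --> \oo] -->
    - \int[mu]_(xi in `[al, be]) (xi * osc_transform k' q xi).
  have ci l f : oscillating l -> L1 f -> continuous (fun xi => osc_transform l f xi).
    by move=> oscl f1; exact: continuous_osc_transform.
  have cxi l f : oscillating l -> L1 f -> continuous (fun xi => xi * osc_transform l f xi).
    by move=> oscl f1 xi; apply: cvgM; [exact: cvg_id|exact: ci].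
  have ch n : continuous (h n).
    move=> xi; apply: cvgN; apply: cvgD; first exact/ci/L1_cutoff'.
    exact/cxi/L1_cutoff.
  pose b n : R := (4 / n.+1%:R * Q + be * \int[mu]_x `|q x - q x * cutoff n x|) * (be - al).
  have cb : b n @[n --> \oo] --> (0 : R).
    rewrite -[X in _ --> X](mul0r (be - al)); apply: cvgMr_tmp.
    rewrite -[X in _ --> X]addr0; apply: cvgD.
      rewrite -[X in _ --> X](mul0r Q); apply: cvgMr_tmp.
      rewrite -[X in _ --> X](mulr0 4); apply: cvgMl_tmp; exact: cvg_harmonic.
    by rewrite -[X in _ --> X](mulr0 be); apply: cvgMl_tmp.
  apply/subr_cvg0; apply/norm_cvg0P.
  apply: (squeeze_cvgr _ (cvg_cst 0) cb); apply: nearW => n; rewrite normr_ge0/=.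
  rewrite opprK -RintegralD//; first last.
  - by apply: integrable_itv_continuous; exact: cxi.
  - exact: integrable_itv_continuous.
  apply: Rintegral_itv_le => //.
    apply: measurable_funTS; apply: continuous_measurable_fun => xi.
    by apply: cvgD; [exact: ch|exact: cxi].
  move=> xi; rewrite in_itv/= => /andP[axi xib].
  have -> : h n xi + xi * osc_transform k' q xi =
      - osc_transform k (fun x => q x * cutoff' n x) xi +
      xi * osc_transform k' (fun x => q x - q x * cutoff n x) xi.
    by rewrite -osc_transformB//; [rewrite /h; ring|exact: L1_cutoff].
  apply: le_trans (ler_normD _ _) _; apply: lerD.
    rewrite normrN (le_trans (osc_transform_le _ _ _))//; first exact: L1_cutoff'.
    rewrite /Q -RintegralZl//; last exact: (integrable_norm q1).
    apply: le_Rintegral => //.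
    - exact: (integrable_norm (L1_cutoff' n q1)).
    - exact: L1Z (integrable_norm q1).
    - by move=> x _; rewrite normrM mulrC ler_wpM2r// cutoff'_le.
  rewrite normrM ler_pM//; first by rewrite ger0_norm// (le_trans al0).
  by apply: osc_transform_le => //; apply: L1B => //; exact: L1_cutoff.
move: c1; under eq_fun do rewrite hE.
by move=> c1; exact: (cvg_unique _ c1 c2).
Qed.

End FourierOfWeakDerivative.

(** * The propagator on the Fourier side *)
Section Multipliers.
Context {R : realType}.
Local Notation mu := (@lebesgue_measure R).
Local Notation L1 f := (mu.-integrable setT (EFin \o f)).
Implicit Types (f g k q v A B : R -> R) (a t x y al be xi : R) (n : nat).

Lemma oscillatingN k : oscillating k -> oscillating (fun y => - k y).
Proof.
move=> [ck k1 [K K1 dK]]; split.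
- by move=> y; apply: cvgN; exact: ck.
- by move=> y; rewrite normrN.
- exists (fun y => - K y) => y; first by rewrite normrN.
  by apply: is_deriveN.
Qed.

Lemma osc_transformN k f xi : oscillating k -> L1 f ->
  osc_transform (fun y => - k y) f xi = - osc_transform k f xi.
Proof.
move=> osck fi; rewrite -mulN1r /osc_transform -RintegralZl//.
  by apply: eq_Rintegral => x _; ring.
exact: L1_osc_scaled.
Qed.

(** The transform of the derivative is [i xi q^(xi)], whose real part is
    [xi] times the sine transform of [q]. *)
Lemma weak_fourier_derivative q v : is_weak_derivative q v -> L1 q -> inL2 v ->
  weak_fourier v (fun xi => xi * osc_transform sin q xi)
                 (fun xi => xi * osc_transform cos q xi).
Proof.
move=> qv q1 v2.
have cxi k : oscillating k -> continuous (fun xi => xi * osc_transform k q xi).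
  move=> osck xi; apply: cvgM; first exact: cvg_id.
  exact: continuous_osc_transform.
split.
- by apply: continuous_interval_integrable; apply: cxi; exact: oscillating_sin.
- by apply: continuous_interval_integrable; apply: cxi; exact: oscillating_cos.
- move=> al be ab; rewrite (weak_derivative_kernel ab qv q1 v2 oscillating_cos
    (oscillatingN oscillating_sin) (@is_derive_cos R)) -mulN1r -RintegralZl//.
    apply: eq_Rintegral => xi _; rewrite osc_transformN//; first by ring.
    exact: oscillating_sin.
  apply: integrable_itv_continuous; apply: cxi; exact/oscillatingN/oscillating_sin.
- move=> al be ab; exact: (weak_derivative_kernel ab qv q1 v2 oscillating_sin
    oscillating_cos (@is_derive_sin R)).
Qed.

Lemma weak_fourierB f g A B A' B' : inL2 f -> inL2 g ->
  weak_fourier f A B -> weak_fourier g A' B' ->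
  weak_fourier (fun x => f x - g x) (fun xi => A xi - A' xi) (fun xi => B xi - B' xi).
Proof.
move=> f2 g2 [iA iB fA fB] [iA' iB' gA gB].
have split_kernel k al be : oscillating k -> al <= be ->
    \int[mu]_x ((f x - g x) * osc_kernel k al be x) =
    \int[mu]_x (f x * osc_kernel k al be x) - \int[mu]_x (g x * osc_kernel k al be x).
  move=> osck ab; have K2 := inL2_osc_kernel osck ab.
  rewrite -RintegralB//; [|exact: inL2_integrableM|exact: inL2_integrableM].
  by apply: eq_Rintegral => x _; rewrite mulrBl.
split; [exact: interval_integrableB|exact: interval_integrableB| |].
- move=> al be ab; rewrite split_kernel; [|exact: oscillating_cos|by case/andP: ab].
  by rewrite fA// gA// RintegralB//; [exact: iA.2|exact: iA'.2].
- move=> al be ab; rewrite split_kernel; [|exact: oscillating_sin|by case/andP: ab].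
  by rewrite fB// gB// RintegralB// ?opprB 1?addrC ?opprK//; [exact: iB.2|exact: iB'.2].
Qed.

Lemma weak_fourier_eq f g A B : inL2 f -> inL2 g -> {ae mu, forall x, f x = g x} ->
  weak_fourier f A B -> weak_fourier g A B.
Proof.
move=> f2 g2 fg.
have eq_kernel k al be : oscillating k -> al <= be ->
    \int[mu]_x (g x * osc_kernel k al be x) = \int[mu]_x (f x * osc_kernel k al be x).
  move=> osck ab; have K2 := inL2_osc_kernel osck ab.
  congr fine; apply: ae_eq_integral => //.
  - exact: measurable_int (inL2_integrableM g2 K2).
  - exact: measurable_int (inL2_integrableM f2 K2).
  - by apply: filterS fg => x fgx _; rewrite fgx.
move=> [iA iB fA fB]; split => // al be ab.
- by rewrite eq_kernel ?fA//; [exact: oscillating_cos|case/andP: ab].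
- by rewrite eq_kernel ?fB//; [exact: oscillating_sin|case/andP: ab].
Qed.

(** Real and imaginary parts of [exp (- t p xi) (A xi + i B xi)], where
    [p xi = i xi |xi| + |xi|^(1 + a)]. *)
Definition flowRe a t A B xi := expR (- (t * `|xi| `^ (1 + a))) *
  (cos (t * xi * `|xi|) * A xi + sin (t * xi * `|xi|) * B xi).
Definition flowIm a t A B xi := expR (- (t * `|xi| `^ (1 + a))) *
  (cos (t * xi * `|xi|) * B xi - sin (t * xi * `|xi|) * A xi).

Lemma interval_integrable_flow a t A B : 0 <= t ->
  interval_integrable A -> interval_integrable B ->
  interval_integrable (flowRe a t A B) /\ interval_integrable (flowIm a t A B).
Proof.
move=> t0 iA iB; have [mA _] := iA; have [mB _] := iB.
have mexp : measurable_fun setT (fun xi : R => expR (- (t * `|xi| `^ (1 + a)))).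
  apply: measurableT_comp => //; apply: measurableT_comp => //.
  apply: measurable_funM => //; apply: (measurableT_comp (measurable_powR _)).
  by apply: continuous_measurable_fun; exact: norm_continuous.
have cth : continuous (fun xi : R => t * xi * `|xi|).
  move=> xi; apply: cvgM; first by apply: cvgMl_tmp; exact: cvg_id.
  exact: norm_continuous.
have mcos : measurable_fun setT (fun xi : R => cos (t * xi * `|xi|)).
  apply: (measurableT_comp (continuous_measurable_fun (@continuous_cos R))).
  exact: continuous_measurable_fun.
have msin : measurable_fun setT (fun xi : R => sin (t * xi * `|xi|)).
  apply: (measurableT_comp (continuous_measurable_fun (@continuous_sin R))).
  exact: continuous_measurable_fun.
have bound (e c s p r : R) : 0 <= e <= 1 -> `|c| <= 1 -> `|s| <= 1 ->
    `|e * (c * p + s * r)| <= `|p| + `|r|.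
  move=> /andP[e0 e1] c1 s1; rewrite normrM (ger0_norm e0).
  rewrite (le_trans (ler_piMl _ e1))// (le_trans (ler_normD _ _))//.
  by rewrite !normrM lerD// ler_piMl.
have e01 xi : 0 <= expR (- (t * `|xi| `^ (1 + a))) <= 1.
  by rewrite expR_ge0 -expR0 ler_expR oppr_le0 mulr_ge0// powR_ge0.
have cos1 y : `|cos y| <= 1 :> R by rewrite ler_norml cos_geN1 cos_le1.
have sin1 y : `|sin y| <= 1 :> R by rewrite ler_norml sin_geN1 sin_le1.
have iAB : interval_integrable (fun xi => `|A xi| + `|B xi|).
  by apply: interval_integrableD; exact: interval_integrable_norm.
split; apply: interval_integrable_le iAB.
- by apply: measurable_funM => //; apply: measurable_funD; exact: measurable_funM.
- by move=> xi; exact: bound.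
- by apply: measurable_funM => //; apply: measurable_funB; exact: measurable_funM.
- move=> xi; rewrite [leRHS]addrC.
  have := bound _ _ (- sin (t * xi * `|xi|)) (B xi) (A xi) (e01 xi) (cos1 (t * xi * `|xi|)).
  by rewrite normrN mulNr; apply.
Qed.

(** The multiplier relation holds for some L^2 transforms; uniqueness of weak
    transforms carries it over to the given [A] and [B]. *)
Lemma weak_fourier_U a t f g A B : 0 <= t -> is_U a t f g -> weak_fourier f A B ->
  weak_fourier g (flowRe a t A B) (flowIm a t A B).
Proof.
move=> t0 [fh [gh [ffh ggh ghE]]] fAB.
have [iA iB _ _] := fAB.
have [iRe iIm] := interval_integrable_flow a t0 iA iB.
have AE := weak_fourier_unique (weak_fourierL2 ffh) fAB.
apply: weak_fourier_ae (weak_fourierL2 ggh) iRe iIm _.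
apply: filterS2 ghE AE => xi -> + xi0 => /(_ xi0) [].
rewrite /cexp /flowRe /flowIm; case: (fh xi) => p r /= -> ->.
by rewrite cosN sinN; split; ring.
Qed.

End Multipliers.

(** * Pairing an L^2-valued integral with a fixed function *)
Section RiemannIntegral.
Context {R : realType}.
Local Notation mu := (@lebesgue_measure R).
Local Notation L1 f := (mu.-integrable setT (EFin \o f)).
Implicit Types (f g kappa : R -> R) (t d : R) (n : nat).

Lemma inL2_0 : inL2 (fun=> 0 : R).
Proof.
apply: (@inL2_le _ _ (\1_(`[0, 0]%classic) : R -> R)).
- exact: measurable_cst.
- by move=> x; rewrite normr0.
- exact: inL2_indic.
Qed.

Lemma Rintegral_sum_kernel n (c : nat -> R) (f : nat -> R -> R) kappa :
  (forall i, (i < n)%N -> inL2 (f i)) -> inL2 kappa ->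
  inL2 (fun x => \sum_(0 <= i < n) c i * f i x) /\
  \int[mu]_x ((\sum_(0 <= i < n) c i * f i x) * kappa x) =
  \sum_(0 <= i < n) c i * \int[mu]_x (f i x * kappa x).
Proof.
move=> + k2; elim: n => [_|n ih f2].
  split.
    rewrite (_ : (fun x => _) = fun=> 0); first exact: inL2_0.
    by apply/funext => x; rewrite big_nil.
  under eq_Rintegral do rewrite big_nil mul0r.
  by rewrite big_nil Rintegral_cst//= mul0r.
have [ih1 ih2] := ih (fun i ilt => f2 i (leqW ilt)).
have fn2 := inL2Z (c n) (f2 n (ltnSn n)).
have E : (fun x => \sum_(0 <= i < n.+1) c i * f i x) =
    fun x => (\sum_(0 <= i < n) c i * f i x) + c n * f n x.
  by apply/funext => x; rewrite big_nat_recr.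
split; first by rewrite E; exact: inL2D.
rewrite big_nat_recr//= -ih2 -RintegralZl//; last by apply: inL2_integrableM => //; exact: f2.
rewrite -RintegralD//; first last.
- by apply: L1Z; apply: inL2_integrableM => //; exact: f2.
- exact: inL2_integrableM.
by apply: eq_Rintegral => x _; rewrite big_nat_recr//=; ring.
Qed.

Lemma fine_partition t d : 0 <= t -> 0 < d -> exists s : seq R,
  itv_partition 0 t s /\
  forall i, (i < size s)%N -> nth t (0 :: s) i.+1 - nth t (0 :: s) i < d.
Proof.
rewrite le_eqVlt => /predU1P[<- _|t0 d0].
  by exists [::]; split => //; split => /=.
have [m tm] : exists m, t / d < m.+1%:R.
  exists (Num.truncn (t / d)); exact: truncnS_gt.
exists (mkseq (fun i => t * i.+1%:R / m.+1%:R) m.+1).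
have nthE i : (i <= m.+1)%N ->
    nth t (0 :: mkseq (fun i => t * i.+1%:R / m.+1%:R) m.+1) i = t * i%:R / m.+1%:R.
  by case: i => [_|i im]; rewrite /= ?mulr0 ?mul0r// nth_mkseq.
have step i : (i < m.+1)%N ->
    t * i.+1%:R / m.+1%:R - t * i%:R / m.+1%:R = t / m.+1%:R.
  by move=> _; rewrite -mulrBl -mulrBr -natrB// subSnn mulr1.
split; [split|].
- apply/(pathP t) => i; rewrite size_mkseq => im.
  rewrite nthE ?(ltnW im)// nth_mkseq// -subr_gt0 step//.
  exact: divr_gt0.
- by rewrite (last_nth t) size_mkseq nthE// mulfK.
- move=> i; rewrite size_mkseq => im; rewrite !nthE ?(ltnW im)// step//.
  by rewrite ltr_pdivrMr// mulrC -ltr_pdivrMr.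
Qed.

(** An L^2-valued Riemann integral need not be known pointwise: pairing with
    [kappa] commutes with Riemann sums, and the pairing of the error is
    controlled by Cauchy-Schwarz. *)
Lemma L2_integral_functional_le t (F : R -> R -> R) (G : R -> R) kappa (B : R) :
  0 <= t -> is_L2_integral 0 t F G -> inL2 kappa ->
  (forall tau, tau \in `[0, t] -> `|\int[mu]_x (F tau x * kappa x)| <= B) ->
  `|\int[mu]_x (G x * kappa x)| <= t * B.
Proof.
move=> t0 [F2 G2 FG] k2 FB.
set C := fine (L2norm kappa).
have C0 : 0 <= C by rewrite fine_ge0// Lnorm_ge0.
have kC : L2norm kappa = C%:E.
  by rewrite fineK// ge0_fin_numE ?Lnorm_ge0//; exact: inL2_lty.
apply/ler_addgt0Pr => e e0.
have [|d d0 dFG] := FG (e / (1 + C)); first by rewrite divr_gt0// ltr_pwDl.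
have [s [sp sd]] := fine_partition t0 d0.
pose p := nth t (0 :: s).
have pin i : (i <= size s)%N -> p i \in `[0, t].
  move=> is_; rewrite in_itv/= (itv_partition_nth_ge _ sp)//=.
  by rewrite (itv_partition_nth_le _ sp).
have pS i : (i < size s)%N -> p i <= p i.+1.
  by move=> im; case: sp => /(pathP t)/(_ _ im) /ltW.
have tagp i : (i < size s)%N ->
    p i.+1 - p i < d /\ p i \in `[p i, p i.+1].
  by move=> im; rewrite in_itv/= lexx pS// sd.
(* the left end points of the partition serve as tags *)
have close := dFG s p sp tagp.
have [S2 SE] := @Rintegral_sum_kernel (size s) (fun i => p i.+1 - p i)
  (fun i => F (p i)) kappa (fun i im => F2 _ (pin i (ltnW im))) k2.
have Sle : `|\int[mu]_x (riemann_sum 0 t s p F x * kappa x)| <= t * B.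
  rewrite /riemann_sum SE (le_trans (ler_norm_sum _ _ _))//.
  have -> : t * B = \sum_(0 <= i < size s) (p i.+1 - p i) * B.
    rewrite -mulr_suml telescope_sumr// /p/= (itv_partition_nth_size _ sp).
    by rewrite subr0.
  rewrite !big_nat; apply: ler_sum => i /andP[_ im].
  rewrite normrM ger0_norm ?subr_ge0 ?pS// ler_wpM2l ?subr_ge0 ?pS//.
  exact/FB/pin/ltnW.
have D2 : inL2 (fun x => riemann_sum 0 t s p F x - G x) by exact: inL2B.
have Dle : `|\int[mu]_x ((riemann_sum 0 t s p F x - G x) * kappa x)| <= e.
  rewrite -lee_fin (le_trans (cauchy_schwarz D2 k2))// kC.
  rewrite (@le_trans _ _ ((e / (1 + C))%:E * C%:E)%E)//.
    by rewrite lee_wpmul2r// ltW.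
  rewrite -EFinM lee_fin mulrAC ler_pdivrMr ?ltr_pwDl//.
  by rewrite ler_pM2l// lerDr.
have -> : \int[mu]_x (G x * kappa x) =
    \int[mu]_x (riemann_sum 0 t s p F x * kappa x) -
    \int[mu]_x ((riemann_sum 0 t s p F x - G x) * kappa x).
  rewrite -RintegralB//; [|exact: inL2_integrableM|exact: inL2_integrableM].
  by apply: eq_Rintegral => x _; ring.
by rewrite (le_trans (ler_normB _ _))// lerD.
Qed.

End RiemannIntegral.

(** * Uniform bounds in time *)
Section UniformBound.
Context {R : realType}.
Local Notation mu := (@lebesgue_measure R).
Implicit Types (f g : R -> R) (t : R).

Lemma weighted_L2norm_le_Z s r f : (weighted_L2norm r f <= Z_norm s r f)%E.
Proof.
rewrite /Z_norm -[leLHS]poweRe1 ?Lnorm_ge0// -[X in (_ `^ X)%E](@mulfV _ 2)//.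
rewrite poweRrM; apply: gt0_ler_poweR => //.
- by rewrite in_itv/= leey andbT poweR_ge0.
- by rewrite in_itv/= leey andbT adde_ge0// poweR_ge0.
- by rewrite leeDr// poweR_ge0.
Qed.

Lemma weighted_fineK r f : in_weighted_L2 r f ->
  weighted_L2norm r f = (fine (weighted_L2norm r f))%:E.
Proof. by move=> fr; rewrite fineK// ge0_fin_numE ?Lnorm_ge0//; exact: inL2_lty. Qed.

Lemma weighted_dist_le r f g (e : R) : in_weighted_L2 r f -> in_weighted_L2 r g ->
  (weighted_L2norm r (fun x => (f x - g x)%R) < e%:E)%E ->
  fine (weighted_L2norm r f) <= fine (weighted_L2norm r g) + e.
Proof.
move=> fr gr fg; rewrite -lee_fin EFinD -!weighted_fineK//.
have dr : in_weighted_L2 r (fun x => f x - g x).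
  rewrite /in_weighted_L2 (_ : (fun x => _) =
    fun x => japanese x `^ r * f x - japanese x `^ r * g x); first exact: inL2B.
  by apply/funext => x; rewrite mulrBr.
apply: (@le_trans _ _ (weighted_L2norm r g + weighted_L2norm r (fun x => (f x - g x)%R))%E).
  rewrite /weighted_L2norm (_ : (fun x => (japanese x `^ r * f x)%R) =
    fun x => japanese x `^ r * g x + japanese x `^ r * (f x - g x)).
    exact: L2normD.
  by apply/funext => x; ring.
by rewrite leeD2l// ltW.
Qed.

(** The weighted norm is continuous in time, by the triangle inequality, and
    the time interval is compact. *)
Lemma continuous_in_Z_bounded s r T u : 0 <= T -> continuous_in_Z s r T u ->
  exists2 M : R, 0 <= M & forall t, t \in `[0, T] ->
    fine (weighted_L2norm r (u t)) <= M.
Proof.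
move=> T0 [uZ ucont].
have ur t : t \in `[0, T] -> in_weighted_L2 r (u t) by move=> /uZ[].
have cN : {within `[0, T], continuous (fun t => fine (weighted_L2norm r (u t)))}.
  apply/subspace_continuousP => t0 t0T; apply/cvgrPdist_le => e e0.
  have wlt : \forall t \near within `[0, T] (nbhs t0),
      (weighted_L2norm r (fun x => (u t x - u t0 x)%R) < e%:E)%E.
    have Zlt := cvg0e_lt (ucont t0 t0T) e0.
    by apply: filterS (Zlt _) => t; apply: le_lt_trans; exact: weighted_L2norm_le_Z.
  have inT : \forall t \near within `[0, T] (nbhs t0), t \in `[0, T].
    exact: withinT.
  apply: filterS2 wlt inT => t tlt tT.
  have tlt' : (weighted_L2norm r (fun x => (u t0 x - u t x)%R) < e%:E)%E.
    move: tlt; rewrite /weighted_L2norm -L2normN.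
    by under eq_fun do rewrite -mulrN opprB.
  rewrite ler_norml lerBlDr lerBrDl; apply/andP; split.
    by rewrite lerBlDr; apply: weighted_dist_le tlt; exact: ur.
  by rewrite addrC; apply: weighted_dist_le tlt'; exact: ur.
have [c cT cmax] := EVT_max T0 cN.
by exists (fine (weighted_L2norm r (u c))) => //; rewrite fine_ge0// Lnorm_ge0.
Qed.

End UniformBound.

(** * Low frequencies of the nonlinearity *)
Section TransformBounds.
Context {R : realType}.
Local Notation mu := (@lebesgue_measure R).
Local Notation L1 f := (mu.-integrable setT (EFin \o f)).
Implicit Types (q : R -> R) (a t x y z xi : R).

Lemma norm_sin_le y : `|sin y| <= `|y|.
Proof.
wlog y0 : y / 0 < y => [H|].
  have [y0|y0|<-] := ltgtP 0 y; first exact: H.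
    by rewrite -normrN -sinN -[leRHS]normrN; apply: H; rewrite oppr_gt0.
  by rewrite sin0.
have [c _ E] : exists2 c, c \in `]0, y[ & sin y - sin 0 = cos c * (y - 0) :> R.
  apply: MVT => //.
  exact/continuous_subspaceT/continuous_sin.
move: E; rewrite sin0 !subr0 => ->.
by rewrite normrM ler_piMl// ler_norml cos_geN1 cos_le1.
Qed.

Lemma norm_cosB1_le y : `|cos y - 1| <= y ^+ 2.
Proof.
have -> : cos y - 1 = - 2 * sin (y / 2) ^+ 2 :> R.
  have -> : y = (y / 2) *+ 2 by rewrite mulr2n; field.
  rewrite cos_mulr2n mulr2n; have := cos2Dsin2 ((y / 2) *+ 2 / 2).
  have -> : (y / 2) *+ 2 / 2 = y / 2 by rewrite mulr2n; field.
  by move=> E; lra.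
have h : sin (y / 2) ^+ 2 <= (y / 2) ^+ 2.
  rewrite -[leLHS]real_normK ?num_real// -[leRHS]real_normK ?num_real//.
  by rewrite lerXn2r ?nnegrE ?norm_sin_le.
have e : (y / 2) ^+ 2 = y ^+ 2 / 4 by field.
move: h; rewrite e mulNr normrN ger0_norm; last by apply: mulr_ge0; rewrite ?sqr_ge0.
by have := sqr_ge0 y; set Y := y ^+ 2; set S := sin _ ^+ 2 => *; lra.
Qed.

Lemma norm_sinB_le y : `|sin y - y| <= `|y| ^+ 3.
Proof.
wlog y0 : y / 0 < y => [H|].
  have [y0|y0|<-] := ltgtP 0 y; first exact: H.
    have := H (- y); rewrite oppr_gt0 sinN -opprD !normrN; exact.
  by rewrite sin0 subr0 normr0 expr0n.
have dF x : is_derive x 1 (fun x : R => sin x - x) (cos x - 1).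
  by apply: is_deriveB.
have [c cy E] : exists2 c, c \in `]0, y[ & (sin y - y) - (sin 0 - 0) = (cos c - 1) * (y - 0) :> R.
  apply: (@MVT _ (fun x : R => sin x - x) (fun x : R => cos x - 1)) => //.
  apply: continuous_subspaceT => x; apply: cvgB; [exact: continuous_sin|exact: cvg_id].
move: E; rewrite sin0 !subr0 => ->; move: cy; rewrite in_itv/= => /andP[c0 cy].
rewrite normrM (gtr0_norm y0) exprSr ler_wpM2r ?(ltW y0)//.
by rewrite (le_trans (norm_cosB1_le c))// lerXn2r ?nnegrE ?ltW.
Qed.

(** All four bounds come from [1 - z <= exp (- z) <= 1 / (1 + z)]. *)
Lemma expRB1_bounds z : 0 <= z ->
  [/\ 0 <= expR (- z), expR (- z) <= 1, `|expR (- z) - 1| <= z &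
      `|expR (- z) - 1 + z| <= z ^+ 2].
Proof.
move=> z0; have e0 : 0 < expR (- z) by exact: expR_gt0.
have e1 : expR (- z) <= 1 by rewrite -expR0 ler_expR oppr_le0.
have lo : 1 - z <= expR (- z) by exact: expR_ge1Dx.
have hi : expR (- z) * (1 + z) <= 1.
  by rewrite -[leRHS](expRxMexpNx_1 z) mulrC ler_wpM2r ?(ltW e0)// expR_ge1Dx.
split; [exact: ltW|exact: e1| |].
- by rewrite ler0_norm ?subr_le0//; lra.
- by rewrite ger0_norm; nra.
Qed.

Lemma sqr_le_powR a xi : 0 < xi <= 1 -> a <= 1 -> xi ^+ 2 <= xi `^ (1 + a).
Proof.
move=> xi01 a1; have /andP[xi0 _] := xi01; rewrite -powR_mulrn ?(ltW xi0)//.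
by apply: ger_powR => //; lra.
Qed.

(** [q] stands for the nonlinearity [u^2 / 2], of which [u \in Z_(1,1)] gives
    two moments. *)
Context (q : R -> R) (q_ge0 : forall x, 0 <= q x).
Hypothesis q2 : L1 (fun x => (1 + x ^+ 2) * q x).
Hypothesis mq : measurable_fun setT q.
Let D := \int[mu]_x ((1 + x ^+ 2) * q x).

Lemma second_moment_L1 : L1 q.
Proof.
apply: (L1_le mq q2) => x; rewrite ger0_norm// ler_peMl// lerDl.
exact: sqr_ge0.
Qed.

Lemma second_moment_le (m : R -> R) (c : R) : 0 <= c -> L1 (fun x => q x * m x) ->
  (forall x, `|m x| <= c * (1 + x ^+ 2)) -> `|\int[mu]_x (q x * m x)| <= c * D.
Proof.
move=> c0 qm mc; apply: le_trans (le_normr_Rintegral _ qm) _ => //.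
rewrite /D -RintegralZl//; apply: le_Rintegral => //.
- exact: (integrable_norm qm).
- exact: L1Z.
- by move=> x _; rewrite normrM ger0_norm// mulrC mulrA ler_wpM2r.
Qed.

Lemma second_moment_ge0 : 0 <= D.
Proof. by apply: Rintegral_ge0 => x _; rewrite mulr_ge0// addr_ge0// sqr_ge0. Qed.

Lemma osc_transform_second_moment xi :
  [/\ `|osc_transform cos q xi| <= D, `|osc_transform sin q xi| <= `|xi| * D &
      `|osc_transform cos q xi - \int[mu]_x q x| <= xi ^+ 2 * D].
Proof.
have q1 := second_moment_L1.
have qc := L1_osc_scaled oscillating_cos xi q1.
have qs := L1_osc_scaled oscillating_sin xi q1.
split.
- rewrite -[leRHS]mul1r; apply: second_moment_le => // x; rewrite mul1r.
  by rewrite (@le_trans _ _ 1)// ?ler_norml ?cos_geN1 ?cos_le1// lerDl sqr_ge0.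
- apply: second_moment_le => // x; rewrite (le_trans (norm_sin_le _))//.
  rewrite normrM ler_wpM2l// -(real_normK (num_real x)).
  have : 0 <= (1 - `|x|) ^+ 2 by exact: sqr_ge0.
  by have := normr_ge0 x; nra.
- rewrite /osc_transform -RintegralB//.
  under eq_Rintegral => x _ do rewrite -{2}[q x]mulr1 -mulrBr.
  apply: second_moment_le; first exact: sqr_ge0.
    rewrite (_ : (fun x => _) = fun x => q x * cos (xi * x) - q x); first exact: L1B.
    by apply/funext => x; rewrite mulrBr mulr1.
  move=> x; rewrite (le_trans (norm_cosB1_le _))// exprMn ler_wpM2l ?sqr_ge0//.
  by rewrite lerDr.
Qed.

(** For the linearly evolved derivative of [q], whose transform is
    [exp (- t p) i xi q^(xi)], the first nontrivial contribution to the real part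
    is of order [xi^2], because [q^] is real up to [O(xi)] and the phase
    [t xi^2] costs two more powers. The imaginary part is [xi] times the
    integral of [q], up to one factor [xi^(1 + a)] coming from
    [exp (- t xi^(1 + a)) - 1]. *)
Lemma flow_nonlinearity_bounds a t T xi : 0 < a -> a <= 1 -> 0 <= t <= T -> 0 < xi <= 1 ->
  let A xi := xi * osc_transform sin q xi in
  let B xi := xi * osc_transform cos q xi in
  `|flowRe a t A B xi| <= (1 + T) ^+ 2 * D * xi ^+ 2 /\
  `|flowIm a t A B xi - xi * \int[mu]_x q x| <=
    (1 + T) ^+ 2 * D * (xi `^ (1 + a) * xi).
Proof.
move=> a0 a1 /andP[t0 tT] xi01 A B; have /andP[xi0 xi1] := xi01.
have [qc qs qd] := osc_transform_second_moment xi.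
have D0 := second_moment_ge0.
have p2 := sqr_le_powR xi01 a1.
have p0 : 0 <= xi `^ (1 + a) by exact: powR_ge0.
have p1 : xi `^ (1 + a) <= 1 by rewrite -[leRHS](powRr0 xi); apply: ger_powR => //; lra.
rewrite /flowRe /flowIm /A /B (gtr0_norm xi0).
move: qc qs qd p0 p1 p2; rewrite (gtr0_norm xi0).
set C := osc_transform cos q xi; set S := osc_transform sin q xi.
set A0 := \int[mu]_x q x; set p := xi `^ (1 + a).
move=> qc qs qd p0 p1 p2.
have tp0 : 0 <= t * p by rewrite mulr_ge0.
have [e0 e1 eB _] := expRB1_bounds tp0.
set e := expR _ in e0 e1 eB *.
have -> : t * xi * xi = t * xi ^+ 2 by rewrite -mulrA.
set th := t * xi ^+ 2.
have en : `|e| <= 1 by rewrite ger0_norm.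
have th0 : 0 <= th by rewrite mulr_ge0// sqr_ge0.
have s1 : `|sin th| <= th by rewrite (le_trans (norm_sin_le _))// ger0_norm.
have c1 : `|cos th| <= 1 by rewrite ler_norml cos_geN1 cos_le1.
have cB := norm_cosB1_le th.
split.
- apply: (@le_trans _ _ (1 * (1 * (xi * (xi * D)) + th * (xi * D)))).
    rewrite normrM ler_pM// (le_trans (ler_normD _ _))//.
    by rewrite lerD// normrM ler_pM// normrM ?(gtr0_norm xi0) ler_pM2l.
  rewrite mul1r mul1r /th.
  have -> : xi * (xi * D) + t * xi ^+ 2 * (xi * D) = (1 + t * xi) * D * xi ^+ 2 by ring.
  rewrite ler_wpM2r ?sqr_ge0// ler_wpM2r//.
  by nra.
- have -> : e * (cos th * (xi * C) - sin th * (xi * S)) - xi * A0 =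
    (e * (cos th - 1) + (e - 1)) * (xi * C) + (- (e * sin th)) * (xi * S) + xi * (C - A0).
    by ring.
  have th1 : th <= t * p by rewrite ler_wpM2l.
  have th2 : th ^+ 2 <= t ^+ 2 * p.
    rewrite /th exprMn ler_wpM2l ?sqr_ge0//.
    by rewrite (le_trans _ p2)// -exprM; apply: ler_wiXn2l => //; exact: ltW.
  apply: (@le_trans _ _ ((t ^+ 2 * p + t * p) * (xi * D) + t * p * (xi * (xi * D)) + xi * (xi ^+ 2 * D))).
    apply: le_trans (ler_normD _ _) _; apply: lerD; last first.
      by rewrite normrM (gtr0_norm xi0) ler_pM2l.
    apply: le_trans (ler_normD _ _) _; apply: lerD.
      rewrite normrM ler_pM//; last by rewrite normrM (gtr0_norm xi0) ler_pM2l.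
      apply: le_trans (ler_normD _ _) _; apply: lerD => //.
      rewrite normrM -[leRHS]mul1r ler_pM//.
      exact: le_trans cB th2.
    rewrite normrM normrN ler_pM//; last by rewrite normrM (gtr0_norm xi0) ler_pM2l.
    by rewrite normrM -[leRHS]mul1r ler_pM// (le_trans s1).
  have -> : (t ^+ 2 * p + t * p) * (xi * D) + t * p * (xi * (xi * D)) + xi * (xi ^+ 2 * D) =
    (t ^+ 2 * p + t * p + t * p * xi + xi ^+ 2) * D * xi by ring.
  rewrite [leRHS]mulrA ler_wpM2r ?(ltW xi0)// [leRHS]mulrAC ler_wpM2r//.
  apply: (@le_trans _ _ ((1 + t) ^+ 2 * p)); first by nra.
  by rewrite ler_wpM2r// lerXn2r ?nnegrE ?addr_ge0 ?lerD2l// (le_trans t0).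
Qed.

End TransformBounds.

(** * The Duhamel term on the Fourier side *)
Section DuhamelTransform.
Context {R : realType}.
Local Notation mu := (@lebesgue_measure R).
Local Notation L1 f := (mu.-integrable setT (EFin \o f)).
Implicit Types (f g : R -> R) (a t T xi : R) (u : R -> R -> R).

(** [duhamelRe + i duhamelIm] is [exp (- t p) u^(xi, 0) - u^(xi, t)], the
    transform of the Duhamel integral of [duhamel_transform]. *)
Definition duhamelRe a u t xi :=
  flowRe a t (osc_transform cos (u 0)) (fun xi => - osc_transform sin (u 0) xi) xi
  - osc_transform cos (u t) xi.
Definition duhamelIm a u t xi :=
  flowIm a t (osc_transform cos (u 0)) (fun xi => - osc_transform sin (u 0) xi) xi
  + osc_transform sin (u t) xi.

(** At [t = 0] the integral equation says [u 0 = U(0) phi], and the symbol of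
    [U(0)] is 1. Only weak transforms of [phi] and [u 0] are compared, so no
    inversion formula is involved. *)
Lemma weak_fourier_initial a T phi u : 0 <= T -> is_solution a T phi u ->
  in_weighted_L2 1 (u 0) ->
  inL2 phi /\ weak_fourier phi (osc_transform cos (u 0))
    (fun xi => - osc_transform sin (u 0) xi).
Proof.
move=> T0 sol u0w.
have u02 := weighted_L2_inL2 u0w; have u01 := weighted_L2_L1 u0w.
have z0T : (0 : R) \in `[0, T] by rewrite in_itv/= lexx.
have [w [v [F [G [[fh [gh [pfh wgh ghE]]] _ FG uE]]]]] := sol 0 z0T.
have [phi2 _ _] := pfh; have [w2 _ _] := wgh; have [F2 G2 _] := FG.
split => //.
have iz : interval_integrable (fun=> 0 : R).
  by apply: continuous_interval_integrable; exact: cst_continuous.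
have G0 k al be : oscillating k -> al <= be ->
    \int[mu]_x (G x * osc_kernel k al be x) = 0.
  move=> osck ab; apply/eqP; rewrite -normr_le0.
  have := L2_integral_functional_le (lexx 0) FG (inL2_osc_kernel osck ab).
  move=> /(_ `|\int[mu]_x (F 0 x * osc_kernel k al be x)|); rewrite mul0r; apply.
  by move=> tau; rewrite in_itv/= => /andP[t0 t0']; rewrite (_ : tau = 0)//; apply/eqP; rewrite eq_le t0 t0'.
have wfG : weak_fourier G (fun=> 0) (fun=> 0).
  split => // al be /andP[_ ab]; rewrite Rintegral_cst//= mul0r ?oppr0 G0//.
  - exact: oscillating_cos.
  - exact: oscillating_sin.
have wfw := weak_fourierL2 wgh.
have wfu : weak_fourier (u 0) (fun xi => complex.Re (gh xi) - 0) (fun xi => complex.Im (gh xi) - 0).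
  apply: (@weak_fourier_eq _ (fun x => w x - G x)) => //.
  - exact: inL2B.
  - by apply: filterS uE => x ->.
  - exact: weak_fourierB.
have [iA iB _ _] := weak_fourier_L1 u01.
apply: weak_fourier_ae (weak_fourierL2 pfh) iA iB _.
have := weak_fourier_unique wfu (weak_fourier_L1 u01).
apply: filterS2 ghE => xi -> + xi0 => /(_ xi0).
case: (fh xi) => p r; rewrite /cexp/= !mul0r !oppr0 expR0 cos0 sin0.
by move=> [<- <-]; split; ring.
Qed.

(** The last clause transfers to the Duhamel integral any bound on a pairing
    that holds for [U(t - tau)] applied to [u u_x], uniformly in [tau]. *)
Lemma duhamel_transform a T phi u t : 0 <= T -> is_solution a T phi u ->
  (forall t, t \in `[0, T] -> in_weighted_L2 1 (u t)) -> t \in `[0, T] ->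
  exists G, [/\ inL2 G, weak_fourier G (duhamelRe a u t) (duhamelIm a u t) &
    forall (kappa : R -> R) (B : R), inL2 kappa ->
      (forall tau v f, tau \in `[0, t] ->
         is_weak_derivative (fun x => 2^-1 * u tau x ^+ 2) v ->
         is_U a (t - tau) v f -> `|\int[mu]_x (f x * kappa x)| <= B) ->
      `|\int[mu]_x (G x * kappa x)| <= t * B].
Proof.
move=> T0 sol uw tT.
have z0T : (0 : R) \in `[0, T] by rewrite in_itv/= lexx.
have t0 : 0 <= t by move: tT; rewrite in_itv/= => /andP[].
have [phi2 wphi] := weak_fourier_initial T0 sol (uw 0 z0T).
have [w [v [F [G [Uw vF FG uE]]]]] := sol t tT.
have [_ G2 _] := FG.
have u2 := weighted_L2_inL2 (uw t tT); have u1 := weighted_L2_L1 (uw t tT).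
have w2 : inL2 w by case: Uw => ? [? [_ []]].
exists G; split => //.
- apply: (@weak_fourier_eq _ (fun x => w x - u t x)) => //.
  + exact: inL2B.
  + by apply: filterS uE => x ->; rewrite subKr.
  + have := weak_fourierB w2 u2 (weak_fourier_U t0 Uw wphi) (weak_fourier_L1 u1).
    rewrite /duhamelIm; by under [X in weak_fourier _ _ X]eq_fun do rewrite opprK.
- move=> kappa B k2 FB; apply: (L2_integral_functional_le t0 FG k2) => tau tau_t.
  by have [vd Uv] := vF tau tau_t; exact: FB vd Uv.
Qed.

End DuhamelTransform.

(** * Low frequencies of the Duhamel term *)
Section DuhamelBounds.
Context {R : realType}.
Local Notation mu := (@lebesgue_measure R).
Local Notation L1 f := (mu.-integrable setT (EFin \o f)).
Implicit Types (f g A B : R -> R) (a t T xi al be : R) (u : R -> R -> R).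

Lemma Rintegral_itv_id al be : al <= be ->
  \int[mu]_(x in `[al, be]) x = (be ^+ 2 - al ^+ 2) / 2.
Proof.
rewrite le_eqVlt => /predU1P[->|ab].
  by rewrite set_itv1 Rintegral_set1 subrr mul0r.
have dF (x : R) : is_derive x 1 (fun y : R => 2^-1 * y ^+ 2) x.
  by apply: is_derive_eq; rewrite /GRing.scale/=; field.
have cF (y : R) : {for y, continuous (fun y : R => 2^-1 * y ^+ 2)}.
  apply: differentiable_continuous.
  by apply/derivable1_diffP; exact: ex_derive.
rewrite /Rintegral (@continuous_FTC2 _ _ (fun y : R => 2^-1 * y ^+ 2))//=; first by field.
- by apply: continuous_subspaceT => x; exact: cvg_id.
- split.
  + by move=> y _; exact: ex_derive.
  + by apply: cvg_at_right_filter; exact: cF.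
  + by apply: cvg_at_left_filter; exact: cF.
- by move=> y _; rewrite derive1E; exact: derive_val.
Qed.

(** Recovers a value of a transform from its integrals over intervals. *)
Lemma average_cvg A xi (e : R) : interval_integrable A ->
  {for xi, continuous A} -> 0 < e -> exists2 d0 : R, 0 < d0 &
  forall d, 0 < d < d0 -> `|\int[mu]_(x in `[xi, xi + d]) A x - d * A xi| <= e * d.
Proof.
move=> iA cA e0; have /cvgrPdist_le/(_ _ e0) [d0 /= d00 Ad] := cA.
exists d0 => // d /andP[d1 d2].
have xid : xi <= xi + d by rewrite lerDl ltW.
have -> : d * A xi = \int[mu]_(x in `[xi, xi + d]) A xi.
  by rewrite Rintegral_itv_cst// [xi + d]addrC addrK.
have icst : mu.-integrable `[xi, xi + d] (EFin \o (fun=> A xi)).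
  by apply: integrable_itv_continuous; exact: cst_continuous.
rewrite -RintegralB//; last exact: iA.2.
rewrite (_ : e * d = e * (xi + d - xi)); last by rewrite [xi + d]addrC addrK.
apply: Rintegral_itv_le => //.
  by apply: measurable_funTS; apply: measurable_funB => //; exact: iA.1.
move=> x; rewrite in_itv/= => /andP[x1 x2]; rewrite distrC; apply: Ad => /=.
by rewrite distrC ger0_norm ?subr_ge0// ltrBlDl (le_lt_trans x2)// ltrD2l.
Qed.

Lemma continuous_flow a t A B xi : 0 < xi -> continuous A -> continuous B ->
  {for xi, continuous (flowRe a t A B)} /\ {for xi, continuous (flowIm a t A B)}.
Proof.
move=> xi0 cA cB.
have cp : {for xi, continuous (fun x : R => `|x| `^ (1 + a))}.
  apply: (@continuous_comp _ _ _ (fun x : R => `|x|) (fun x : R => x `^ (1 + a))).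
    exact: norm_continuous.
  rewrite gtr0_norm//; apply: (differentiable_continuous (f := fun x : R => x `^ (1 + a))).
  by apply/derivable1_diffP; have [] := is_derive1_powR (1 + a) xi0.
have ce : {for xi, continuous (fun x : R => expR (- (t * `|x| `^ (1 + a))))}.
  apply: (@continuous_comp _ _ _ (fun x : R => - (t * `|x| `^ (1 + a))) expR).
    by apply: cvgN; apply: cvgMl_tmp; exact: cp.
  exact: continuous_expR.
have cth : {for xi, continuous (fun x : R => t * x * `|x|)}.
  apply: cvgM; first by apply: cvgMl_tmp; exact: cvg_id.
  exact: norm_continuous.
have cc : {for xi, continuous (fun x : R => cos (t * x * `|x|))}.
  apply: (@continuous_comp _ _ _ (fun x : R => t * x * `|x|) cos) => //.
  exact: continuous_cos.
have cs : {for xi, continuous (fun x : R => sin (t * x * `|x|))}.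
  apply: (@continuous_comp _ _ _ (fun x : R => t * x * `|x|) sin) => //.
  exact: continuous_sin.
split; apply: cvgM => //.
- by apply: cvgD; apply: cvgM => //; [exact: cA|exact: cB].
- by apply: cvgB; apply: cvgM => //; [exact: cB|exact: cA].
Qed.

(** Under pairing, minus the integral over [[al, be]] of
    [2 (B(2 xi) - 2 B(xi))]: the dilation doubles the length of the interval,
    which is why the factor is 4 and not 2. It annihilates a [B] that is linear
    in [xi]. *)
Definition dilation_kernel al be x :=
  osc_kernel sin (2 * al) (2 * be) x - 4 * osc_kernel sin al be x.

Lemma inL2_dilation_kernel al be : al <= be -> inL2 (dilation_kernel al be).
Proof.
move=> ab; apply: inL2B; last apply: inL2Z; apply: inL2_osc_kernel => //;
  by [exact: oscillating_sin|rewrite ler_pM2l].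
Qed.

Lemma dilation_kernelE f A B al be : 0 <= al <= be -> inL2 f -> weak_fourier f A B ->
  \int[mu]_x (f x * dilation_kernel al be x) =
  4 * \int[mu]_(xi in `[al, be]) B xi - \int[mu]_(xi in `[2 * al, 2 * be]) B xi.
Proof.
move=> /andP[al0 ab] f2 [_ _ _ fB].
have K2 c d : c <= d -> inL2 (osc_kernel sin c d : R -> R).
  by apply: inL2_osc_kernel; exact: oscillating_sin.
have ab2 : 2 * al <= 2 * be by rewrite ler_pM2l.
transitivity (\int[mu]_x (f x * osc_kernel sin (2 * al) (2 * be) x) -
              4 * \int[mu]_x (f x * osc_kernel sin al be x)).
  rewrite -RintegralZl//; last by apply: inL2_integrableM => //; exact: K2.
  rewrite -RintegralB//.
  - by apply: eq_Rintegral => x _; rewrite /dilation_kernel; ring.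
  - by apply: inL2_integrableM => //; exact: K2.
  - by apply: L1Z; apply: inL2_integrableM => //; exact: K2.
by rewrite !fB ?al0 ?mulr_ge0//; ring.
Qed.

(** The bounds of [flow_nonlinearity_bounds] integrated over frequency
    intervals; in the second one the linear part of [B], which has no smallness,
    is subtracted on both intervals and cancels. *)
Lemma nonlinearity_kernel_bounds a s T (M : R) g v f al be :
  0 < a -> a <= 1 -> 0 <= s <= T -> in_weighted_L2 1 g ->
  fine (weighted_L2norm 1 g) <= M ->
  is_weak_derivative (fun x => 2^-1 * g x ^+ 2) v -> is_U a s v f ->
  0 < al <= be -> 2 * be <= 1 ->
  let K := (1 + T) ^+ 2 * M ^+ 2 in
  `|\int[mu]_x (f x * osc_kernel cos al be x)| <= K * be ^+ 2 * (be - al) /\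
  `|\int[mu]_x (f x * dilation_kernel al be x)| <=
    6 * (K * ((2 * be) `^ (1 + a) * (2 * be))) * (be - al).
Proof.
move=> a0 a1 sT gw gM vd Uf /andP[al0 ab] be1 K.
have /andP[s0 _] := sT.
have be0 : 0 < be by exact: lt_le_trans ab.
pose q x := 2^-1 * g x ^+ 2.
have q0 x : 0 <= q x by rewrite mulr_ge0// ?invr_ge0// sqr_ge0.
have [g1 gE] := weighted_sqr gw.
have q2E : (fun x => (1 + x ^+ 2) * q x) = fun x => 2^-1 * ((1 + x ^+ 2) * g x ^+ 2).
  by apply/funext => x; rewrite /q; ring.
have q2 : L1 (fun x => (1 + x ^+ 2) * q x) by rewrite q2E; exact: L1Z.
have mq : measurable_fun setT q.
  apply: measurable_funM => //; apply: measurable_funX.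
  exact: weighted_L2_measurable gw.
have N0 : 0 <= fine (weighted_L2norm 1 g) by rewrite fine_ge0// Lnorm_ge0.
have DM : \int[mu]_x ((1 + x ^+ 2) * q x) <= M ^+ 2.
  rewrite q2E RintegralZl// gE.
  have : fine (weighted_L2norm 1 g) ^+ 2 <= M ^+ 2.
    by rewrite lerXn2r// nnegrE (le_trans N0).
  by have := sqr_ge0 (fine (weighted_L2norm 1 g)); lra.
have v2 : inL2 v by case: Uf => ? [? [[]]].
have f2 : inL2 f by case: Uf => ? [? [_ []]].
have q1 := second_moment_L1 q0 q2 mq.
have wv := weak_fourier_derivative vd q1 v2.
have wf := weak_fourier_U s0 Uf wv.
have [iRe iIm fRe _] := wf.
have bnd xi := @flow_nonlinearity_bounds _ q q0 q2 mq a s T xi a0 a1 sT.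
have D0 := second_moment_ge0 q0.
have K0 : 0 <= K by rewrite mulr_ge0 ?sqr_ge0.
have DK : (1 + T) ^+ 2 * \int[mu]_x ((1 + x ^+ 2) * q x) <= K.
  by rewrite ler_wpM2l ?sqr_ge0.
split.
- rewrite fRe ?(ltW al0)//; apply: Rintegral_itv_le => //.
    by apply: measurable_funTS; exact: iRe.1.
  move=> xi; rewrite in_itv/= => /andP[xia xib].
  have xi0 : 0 < xi by exact: lt_le_trans al0 xia.
  have xi01 : 0 < xi <= 1 by rewrite xi0; clear -be1 xib be0; lra.
  have [+ _] := bnd xi xi01 => /le_trans; apply.
  apply: ler_pM; [by rewrite mulr_ge0 ?sqr_ge0|exact: sqr_ge0|exact: DK|].
  by rewrite lerXn2r// nnegrE ltW.
- rewrite (dilation_kernelE _ f2 wf) ?(ltW al0)//.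
  set B := flowIm _ _ _ _ in iIm bnd *.
  pose A0 := \int[mu]_x q x.
  have rem c d : al <= c -> c <= d -> d <= 2 * be ->
      `|\int[mu]_(xi in `[c, d]) B xi - A0 * ((d ^+ 2 - c ^+ 2) / 2)| <=
      K * ((2 * be) `^ (1 + a) * (2 * be)) * (d - c).
    move=> ac cd db; rewrite -Rintegral_itv_id// -RintegralZl//; last first.
      by apply: integrable_itv_continuous => x; exact: cvg_id.
    rewrite -RintegralB//; first last.
    - apply: integrable_itv_continuous => x; apply: cvgMl_tmp; exact: cvg_id.
    - exact: iIm.2.
    apply: Rintegral_itv_le => //.
      apply: measurable_funTS; apply: measurable_funB; first exact: iIm.1.
      exact: measurable_funM.
    move=> xi; rewrite in_itv/= => /andP[xia xib].
    have xib2 : xi <= 2 * be by exact: le_trans xib db.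
    have xi0 : 0 < xi by exact: lt_le_trans al0 (le_trans ac xia).
    have xi01 : 0 < xi <= 1 by rewrite xi0 (le_trans xib2).
    have be20 : 0 <= 2 * be by rewrite mulr_ge0// ltW.
    have pa0 : 0 <= 1 + a by rewrite addr_ge0// ltW.
    have [_] := bnd xi xi01; rewrite [xi * \int[mu]_x q x]mulrC => /le_trans; apply.
    have p0 (y : R) : 0 <= y `^ (1 + a) by exact: powR_ge0.
    apply: ler_pM; [by rewrite mulr_ge0 ?sqr_ge0|by rewrite mulr_ge0 ?p0// ltW|exact: DK|].
    apply: ler_pM => //; first exact: ltW.
    by apply: ge0_ler_powR; rewrite ?nnegrE// ltW.
  have be2 : be <= 2 * be by clear -be0; lra.
  have al2 : al <= 2 * al by clear -al0; lra.
  have ab2 : 2 * al <= 2 * be by rewrite ler_pM2l.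
  have r1 := rem al be (lexx _) ab be2.
  have r2 := rem (2 * al) (2 * be) al2 ab2 (lexx _).
  move: r1 r2; set I1 := \int[mu]_(xi in `[al, be]) B xi; set I2 := \int[mu]_(xi in `[2 * al, 2 * be]) B xi.
  set L := K * _ => r1 r2.
  have -> : 4 * I1 - I2 = 4 * (I1 - A0 * ((be ^+ 2 - al ^+ 2) / 2)) -
      (I2 - A0 * (((2 * be) ^+ 2 - (2 * al) ^+ 2) / 2)) by ring.
  rewrite (le_trans (ler_normB _ _))// normrM ger0_norm//.
  move: r1 r2; set n1 := `|_|; set n2 := `|_| => r1 r2.
  by clear -r1 r2; lra.
Qed.

(** The pairings with kernels of [[xi, xi + d]] are bounded uniformly in [tau]
    by [nonlinearity_kernel_bounds], hence for the Duhamel integral; dividing by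
    [d] and letting [d] tend to 0 gives values at [xi]. The restriction
    [xi <= 8^-1] keeps the doubled interval inside [[0, 1]]. *)
Lemma duhamel_bounds a T phi u : 0 < a -> a <= 1 -> 0 <= T ->
  continuous_in_Z 1 1 T u -> is_solution a T phi u ->
  exists2 K : R, 0 <= K & forall t xi, t \in `[0, T] -> 0 < xi <= 8^-1 ->
    `|duhamelRe a u t xi| <= K * xi ^+ 2 /\
    `|duhamelIm a u t (2 * xi) - 2 * duhamelIm a u t xi| <= K * (xi `^ (1 + a) * xi).
Proof.
move=> a0 a1 T0 ucont sol.
have uw t : t \in `[0, T] -> in_weighted_L2 1 (u t) by move=> /(ucont.1 t)[].
have [M M0 uM] := continuous_in_Z_bounded T0 ucont.
pose K := (1 + T) ^+ 2 * M ^+ 2.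
have K0 : 0 <= K by rewrite mulr_ge0 ?sqr_ge0.
(* [192 = 6 * 64 / 2]: the 6 of [nonlinearity_kernel_bounds], then
   [(4 xi)^(1 + a) * (4 xi) <= 64 xi^(1 + a) xi] as [d <= xi] and [a <= 1], and
   the length [2 d] of the doubled interval. The real part costs a factor 4. *)
exists (192 * (T * K)); first by rewrite mulr_ge0// mulr_ge0.
move=> t xi tT /andP[xi0 xi8].
have /andP[t0 tT'] : 0 <= t <= T by move: tT; rewrite in_itv.
have [G [G2 wG Gle]] := duhamel_transform T0 sol uw tT.
have [iRe iIm GRe _] := wG.
have z0T : (0 : R) \in `[0, T] by rewrite in_itv/= lexx.
have cC s : s \in `[0, T] -> continuous (osc_transform cos (u s)).
  by move=> sT; apply: continuous_osc_transform; [exact: oscillating_cos|exact: weighted_L2_L1 (uw s sT)].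
have cS s : s \in `[0, T] -> continuous (osc_transform sin (u s)).
  by move=> sT; apply: continuous_osc_transform; [exact: oscillating_sin|exact: weighted_L2_L1 (uw s sT)].
have cNS : continuous (fun xi => - osc_transform sin (u 0) xi).
  by move=> x; apply: cvgN; exact: cS.
have cRe x : 0 < x -> {for x, continuous (duhamelRe a u t)}.
  move=> x0; apply: cvgB; last exact: cC.
  exact: (continuous_flow a t x0 (cC 0 z0T) cNS).1.
have cIm x : 0 < x -> {for x, continuous (duhamelIm a u t)}.
  move=> x0; apply: cvgD; last exact: cS.
  exact: (continuous_flow a t x0 (cC 0 z0T) cNS).2.
have kb tau v f d : tau \in `[0, t] -> 0 < d <= xi ->
    is_weak_derivative (fun x => 2^-1 * u tau x ^+ 2) v -> is_U a (t - tau) v f ->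
    `|\int[mu]_x (f x * osc_kernel cos xi (xi + d) x)| <= K * (xi + d) ^+ 2 * d /\
    `|\int[mu]_x (f x * dilation_kernel xi (xi + d) x)| <=
      6 * (K * ((2 * (xi + d)) `^ (1 + a) * (2 * (xi + d)))) * d.
  rewrite in_itv/= => /andP[tau0 taut] /andP[d0 dxi] vd Uv.
  have tauT : tau \in `[0, T] by rewrite in_itv/= tau0 (le_trans taut).
  have -> : K * (xi + d) ^+ 2 * d = K * (xi + d) ^+ 2 * (xi + d - xi) by ring.
  have -> : 6 * (K * ((2 * (xi + d)) `^ (1 + a) * (2 * (xi + d)))) * d =
    6 * (K * ((2 * (xi + d)) `^ (1 + a) * (2 * (xi + d)))) * (xi + d - xi) by ring.
  apply: (nonlinearity_kernel_bounds a0 a1 _ (uw tau tauT) (uM tau tauT) vd Uv).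
  - by rewrite subr_ge0 taut; clear -tau0 tT'; lra.
  - by rewrite xi0; clear -d0; lra.
  - by clear -dxi xi8; lra.
clearbody K; have TK0 : 0 <= T * K by rewrite mulr_ge0.
split; apply/ler_addgt0Pr => e e0.
- have [d0 d00 avg] := average_cvg iRe (cRe xi xi0) e0.
  pose d := Num.min xi (d0 / 2).
  have d_gt0 : 0 < d by rewrite lt_min xi0 divr_gt0.
  have dxi : d <= xi by rewrite ge_min lexx.
  have dd0 : d < d0.
    by rewrite (@le_lt_trans _ _ (d0 / 2))// ?ge_min ?lexx ?orbT//; clear -d00; lra.
  have dle : 0 < d <= xi by rewrite d_gt0.
  have := avg d; rewrite d_gt0 dd0 => /(_ isT) avgd.
  have xid : xi <= xi + d by rewrite lerDl ltW.
  have := Gle _ (K * (xi + d) ^+ 2 * d) (inL2_osc_kernel oscillating_cos xid)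
    (fun tau v f taut vd Uv => (kb tau v f d taut dle vd Uv).1).
  rewrite GRe ?(ltW xi0)//; move: avgd; set I := \int[mu]_(x in _) _ => avgd Ile.
  have : d * `|duhamelRe a u t xi| <= t * (K * (xi + d) ^+ 2 * d) + e * d.
    rewrite -[X in X * _](gtr0_norm d_gt0) -normrM.
    have -> : d * duhamelRe a u t xi = I - (I - d * duhamelRe a u t xi) by ring.
    by rewrite (le_trans (ler_normB _ _))// lerD.
  rewrite (_ : t * (K * (xi + d) ^+ 2 * d) + e * d = d * (t * K * (xi + d) ^+ 2 + e)); last by ring.
  rewrite ler_pM2l// => /le_trans; apply; rewrite lerD2r.
  have tK : t * K <= T * K by rewrite ler_wpM2r.
  have tK0 : 0 <= t * K by rewrite mulr_ge0.
  apply: (@le_trans _ _ (T * K * (4 * xi ^+ 2))).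
    apply: ler_pM => //; first exact: sqr_ge0.
    have -> : 4 * xi ^+ 2 = (2 * xi) ^+ 2 by ring.
    have xd : 0 <= xi + d <= 2 * xi.
      by clear -dxi xi0 d_gt0; apply/andP; split; lra.
    by case/andP: xd => xd0 xd; rewrite lerXn2r// nnegrE// mulr_ge0// ltW.
  by have := sqr_ge0 xi; clear -TK0 => sq; nra.
- have e30 : 0 < e / 3 by rewrite divr_gt0.
  have xi20 : 0 < 2 * xi by rewrite mulr_gt0.
  have [d1 d10 avg1] := average_cvg iIm (cIm xi xi0) e30.
  have [d2 d20 avg2] := average_cvg iIm (cIm (2 * xi) xi20) e30.
  pose d := Num.min xi (Num.min (d1 / 2) (d2 / 4)).
  have d_gt0 : 0 < d by rewrite !lt_min xi0 !divr_gt0.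
  have dxi : d <= xi by rewrite ge_min lexx.
  have dd1 : d <= d1 / 2 by rewrite !ge_min lexx orbT.
  have dd2 : d <= d2 / 4 by rewrite !ge_min lexx !orbT.
  have dle : 0 < d <= xi by rewrite d_gt0.
  have := avg1 d; have -> : 0 < d < d1.
    by rewrite d_gt0; clear -dd1 d10; lra.
  move=> /(_ isT) avgd1.
  have := avg2 (2 * d); have -> : 0 < 2 * d < d2.
    by apply/andP; split; clear -d_gt0 dd2 d20; lra.
  move=> /(_ isT) avgd2.
  have xid : xi <= xi + d by rewrite lerDl ltW.
  have xid0 : 0 <= xi <= xi + d by rewrite xid ltW.
  have := Gle _ (6 * (K * ((2 * (xi + d)) `^ (1 + a) * (2 * (xi + d)))) * d)
    (inL2_dilation_kernel xid)
    (fun tau v f taut vd Uv => (kb tau v f d taut dle vd Uv).2).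
  rewrite (dilation_kernelE xid0 G2 wG) mulrDr.
  move: avgd1 avgd2; set I1 := \int[mu]_(x in `[xi, _]) _; set I2 := \int[mu]_(x in `[2 * xi, _]) _.
  set g1 := duhamelIm a u t xi; set g2 := duhamelIm a u t (2 * xi) => avgd1 avgd2 Ile.
  have p0 : 0 <= xi `^ (1 + a) by exact: powR_ge0.
  have ple : (2 * xi + 2 * d) `^ (1 + a) * (2 * xi + 2 * d) <= 64 * (xi `^ (1 + a) * xi).
    have -> : 64 * (xi `^ (1 + a) * xi) = 16 * xi `^ (1 + a) * (4 * xi) by ring.
    have [xd0 xd4] : 0 <= 2 * xi + 2 * d /\ 2 * xi + 2 * d <= 4 * xi.
      by clear -dxi xi0 d_gt0; split; lra.
    have [a1_ge0 xi4_ge0] : 0 <= 1 + a /\ 0 <= 4 * xi.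
      by clear -a0 xi0; split; lra.
    apply: ler_pM => //; first exact: powR_ge0.
    apply: (@le_trans _ _ ((4 * xi) `^ (1 + a))).
      by apply: ge0_ler_powR; rewrite ?nnegrE.
    rewrite powRM ?(ltW xi0)// ler_wpM2r//.
    have -> : 16 = 4 `^ 2%:R :> R by rewrite powR_mulrn//; ring.
    by clear -a1; apply: ler_powR; lra.
  set p := xi `^ (1 + a) * xi in ple *.
  set p' := _ * (2 * xi + 2 * d) in ple Ile.
  have p'0 : 0 <= p'.
    by rewrite mulr_ge0 ?powR_ge0// addr_ge0// mulr_ge0// ltW.
  have Ile2 : `|4 * I1 - I2| <= 384 * (T * K) * p * d.
    apply: (le_trans Ile).
    have tK : t * K <= T * K by rewrite ler_wpM2r.
    have tK0 : 0 <= t * K by rewrite mulr_ge0.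
    have : t * K * p' <= T * K * (64 * p) by exact: ler_pM.
    have -> : t * (6 * (K * p') * d) = t * K * p' * (6 * d) by ring.
    have -> : 384 * (T * K) * p * d = T * K * (64 * p) * (6 * d) by ring.
    by move=> h; rewrite ler_wpM2r// mulr_ge0// ltW.
  have : 2 * d * `|g2 - 2 * g1| <= 384 * (T * K) * p * d + 2 * d * e.
    rewrite -[X in X * _](gtr0_norm (_ : 0 < 2 * d)) ?mulr_gt0// -normrM.
    have -> : 2 * d * (g2 - 2 * g1) =
      4 * (I1 - d * g1) - (4 * I1 - I2) - (I2 - 2 * d * g2) by ring.
    rewrite (le_trans (ler_normB _ _))// (le_trans (lerD (ler_normB _ _) (lexx _)))//.
    rewrite normrM (ger0_norm (_ : 0 <= 4))//.
    move: avgd1 avgd2 Ile2; set n1 := `|_|; set n2 := `|_|; set n3 := `|_|.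
    by clear => *; lra.
  have -> : 384 * (T * K) * p * d + 2 * d * e = 2 * d * (192 * (T * K) * p + e) by ring.
  by rewrite ler_pM2l// mulr_gt0.
Qed.

End DuhamelBounds.

(** * Spatial decay as smoothness at frequency zero *)
Section DecayToSmoothness.
Context {R : realType}.
Local Notation mu := (@lebesgue_measure R).
Local Notation L1 f := (mu.-integrable setT (EFin \o f)).
Implicit Types (f k h : R -> R) (a r x y xi M c : R).

(** Where [xi |x| <= 1] the cubic bound gives [|k (xi x)| <= c (xi |x|)^r], as
    [r <= 3]; elsewhere one uses [|k| <= c] and [xi |x| <= (xi |x|)^r], as
    [1 <= r]. The resulting bound is integrable in [x], with integral of order
    [xi^(2 r - 1)]. *)
Lemma weighted_kernel_sqr k c r x xi : 0 < xi -> 1 <= r <= 3 -> 0 <= c ->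
  (forall y, `|k y| <= c) -> (forall y, `|k y| <= c * `|y| ^+ 3) ->
  (k (xi * x) * japanese x `^ (- r)) ^+ 2 <=
  2 * (c * xi `^ r) ^+ 2 * (1 + (xi * x) ^+ 2)^-1.
Proof.
move=> xi0 /andP[r1 r3] c0 kc kc3.
have j0 := japanese_gt0 x.
set y := `|xi * x|.
have y0 : 0 <= y by exact: normr_ge0.
have -> : (xi * x) ^+ 2 = y ^+ 2 by rewrite real_normK// num_real.
rewrite -[leLHS]real_normK ?num_real// normrM (ger0_norm (powR_ge0 _ _)).
have lor : 0 < 1 + y ^+ 2 by rewrite ltr_pwDl ?sqr_ge0.
have yE : y = xi * `|x| by rewrite /y normrM gtr0_norm.
have jr : 0 <= japanese x `^ (- r) by exact: powR_ge0.
have xir : 0 <= xi `^ r by exact: powR_ge0.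
have xjr : `|x| `^ r * japanese x `^ (- r) <= 1.
  rewrite powRN ler_pdivrMr ?powR_gt0// mul1r.
  apply: ge0_ler_powR; rewrite ?nnegrE ?(ltW j0) ?japanese_ge_norm//.
  exact: le_trans ler01 r1.
rewrite ler_pdivlMr//; have [y1|y1] := leP y 1.
- have kr : `|k (xi * x)| * japanese x `^ (- r) <= c * xi `^ r.
    apply: (@le_trans _ _ (c * (xi `^ r * `|x| `^ r) * japanese x `^ (- r))).
      rewrite ler_wpM2r// (le_trans (kc3 _))// -/y ler_wpM2l//.
      rewrite -powRM ?(ltW xi0)// -yE.
      have [->|yn0] := eqVneq y 0; first by rewrite expr0n powR_ge0.
      rewrite -powR_mulrn//; apply: ger_powR; last exact: r3.
      by rewrite lt_neqAle eq_sym yn0 y0 y1.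
    by rewrite -mulrA ler_wpM2l// -mulrA ler_piMr.
  rewrite [2 * _]mulrC; apply: ler_pM; rewrite ?sqr_ge0 ?(ltW lor)//.
    by rewrite lerXn2r ?nnegrE ?mulr_ge0.
  by rewrite (_ : 2 = 1 + 1)// lerD2l exprn_ile1.
- have x0 : 0 < `|x| by rewrite -(pmulr_rgt0 _ xi0) -yE (lt_trans _ y1).
  have kr : `|k (xi * x)| * japanese x `^ (- r) * y <= c * xi `^ r.
    rewrite -mulrA; apply: ler_pM => //; first by rewrite mulr_ge0.
    have yr : y <= y `^ r by rewrite -[leLHS]powRr1//; apply: ler_powR => //; exact: ltW.
    apply: (@le_trans _ _ (japanese x `^ (- r) * (xi `^ r * `|x| `^ r))).
      by rewrite ler_wpM2l// -powRM ?(ltW xi0)// -yE.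
    by rewrite mulrCA [_ * `|x| `^ r]mulrC ler_piMr.
  apply: (@le_trans _ _ (2 * (`|k (xi * x)| * japanese x `^ (- r) * y) ^+ 2)).
    have y21 : 1 <= y ^+ 2 by rewrite exprn_ege1// ltW.
    set w := `|k _| * _.
    have -> : 2 * (w * y) ^+ 2 = w ^+ 2 * (2 * y ^+ 2) by ring.
    by rewrite ler_wpM2l ?sqr_ge0//; lra.
  by rewrite ler_pM2l// lerXn2r ?nnegrE ?mulr_ge0.
Qed.

Lemma tail_sqr h (e : R) : inL2 h -> 0 < e -> exists n : nat,
  \int[mu]_x (h x ^+ 2 - ((fun x => h x ^+ 2) \_ `[- n%:R, n%:R]) x) <= e.
Proof.
move=> h2 e0; have hh := inL2_sqr h2.
have mh : measurable_fun setT (fun x => h x ^+ 2) by exact: L1_measurable hh.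
have c0 : (\int[mu]_x (h x ^+ 2 - ((fun x => h x ^+ 2) \_ `[- n%:R, n%:R]) x))
    @[n --> \oo] --> (0 : R).
  rewrite -[X in _ --> X](_ : \int[mu]_x (cst 0 x) = 0); last first.
    by rewrite Rintegral_cst//= mul0r.
  apply: (Rintegral_dominated_cvg _ _ (g := fun x => h x ^+ 2) _ _).2 => //.
  - move=> n; apply: measurable_funB => //.
    by apply/(measurable_restrictT _ _).1 => //; exact: measurable_funTS.
  - move=> x; rewrite /= -[X in _ --> X](subrr (h x ^+ 2)).
    by apply: cvgB; [exact: cvg_cst|exact: (@cvg_truncation _ (fun x => h x ^+ 2))].
  - move=> n x; rewrite patchE; case: ifPn => _; first by rewrite subrr normr0 sqr_ge0.
    by rewrite subr0 ger0_norm// sqr_ge0.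
have /cvgr0_norm_le/(_ _ e0) [n _ /(_ n (leqnn n))] := c0.
by move=> /(le_trans (ler_norm _)) H; exists n.
Qed.

Lemma integral_lorentzR xi : 0 < xi ->
  \int[mu]_x ((1 + (xi * x) ^+ 2)^-1) = pi / xi.
Proof. by move=> xi0; rewrite /Rintegral integral_lorentz. Qed.

(** By Cauchy-Schwarz and [weighted_kernel_sqr] with [r = 3/2 + a], the integral
    is at most a constant times [xi^(r - 1/2) = xi^(1 + a)] times the L^2 norm of
    [<x>^r f]. To turn this into a little-o, only the part of that norm outside
    a large interval [[- n, n]] is used, which is small, and inside the interval
    the cubic bound on [k] gives [O(xi^3)]. *)
Lemma kernel_little_o k c a f (e : R) : 0 < a -> a <= 1 -> 0 <= c ->
  continuous k ->
  (forall y, `|k y| <= c) -> (forall y, `|k y| <= c * `|y| ^+ 3) ->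
  in_weighted_L2 (3 / 2 + a) f -> 0 < e ->
  \forall xi \near 0^'+, `|\int[mu]_x (f x * k (xi * x))| <= e * xi `^ (1 + a).
Proof.
move=> a0 a1 c0 ck kc kc3 fw e0.
set r := 3 / 2 + a in fw.
pose h x := japanese x `^ r * f x.
have hh := inL2_sqr fw.
have f1 : L1 f by apply/weighted_L2_L1/(weighted_L2S _ fw); rewrite /r; lra.
have mf := L1_measurable f1.
have fh x : f x = japanese x `^ (- r) * h x.
  rewrite /h mulrA -powRD ?addNr ?powRr0 ?mul1r//.
  by rewrite (gt_eqF (japanese_gt0 x)) implybT.
set F1 := \int[mu]_x `|f x|.
have F10 : 0 <= F1 by exact: Rintegral_ge0.
(* the tail contributes [e1 / 2 + e1 * (c^2 * pi)], [pi] being the integral of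
   [1 / (1 + x^2)], and this choice makes it at most [e / 3] *)
pose e1 := e / (3 * (1 + c ^+ 2 * pi)).
have cpi : 0 <= c ^+ 2 * pi by rewrite mulr_ge0 ?sqr_ge0 ?pi_ge0.
have e10 : 0 < e1 by rewrite divr_gt0// mulr_gt0// ltr_pwDl.
have e1E : e1 * (1 + c ^+ 2 * pi) = e / 3.
  by rewrite /e1 invfM mulrA mulfVK// gt_eqF// ltr_pwDl.
clearbody e1.
have [n tail] := tail_sqr fw (exprn_gt0 2 e10).
pose H x := h x ^+ 2 - ((fun x => h x ^+ 2) \_ `[- n%:R, n%:R]) x.
have H1 : L1 H.
  apply: (L1_le _ hh).
    apply: measurable_funB; first exact: L1_measurable.
    by apply/(measurable_restrictT _ _).1 => //; apply: measurable_funTS; exact: L1_measurable.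
  move=> x; rewrite /H patchE; case: ifPn => _; first by rewrite subrr normr0 sqr_ge0.
  by rewrite subr0 ger0_norm// sqr_ge0.
pose N : R := n%:R ^+ 3.
have N0 : 0 <= N by rewrite exprn_ge0.
near=> xi.
have xi0 : 0 < xi by near: xi; exact: nbhs_right_gt.
have xi1 : xi <= 1 by near: xi; exact: nbhs_right_le.
have xismall : xi <= e / (3 * (1 + c * N * F1)).
  near: xi; apply: nbhs_right_le; rewrite divr_gt0// mulr_gt0// ltr_pwDl//.
  by rewrite mulr_ge0// mulr_ge0.
set p := xi `^ (1 + a).
have p0 : 0 < p by rewrite powR_gt0.
have rp : (xi `^ r) ^+ 2 = p ^+ 2 * xi.
  rewrite -!powR_mulrn ?powR_ge0// /p -!powRrM.
  have -> : r * 2%:R = (1 + a) * 2%:R + 1 by rewrite /r; field.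
  by rewrite powRD ?(gt_eqF xi0) ?implybT// (powRr1 (ltW xi0)).
have p3 : xi ^+ 3 <= xi * p.
  rewrite exprS ler_wpM2l ?(ltW xi0)//; apply: sqr_le_powR => //.
  by rewrite xi0.
pose L x : R := (1 + (xi * x) ^+ 2)^-1.
have L1L := integrable_lorentz xi0.
(* inside [[- n, n]] the first term is enough; outside, Young's inequality with
   weight [e1 / p] between [<x>^r f] and [k (xi x) <x>^(- r)] *)
have pw x : `|f x * k (xi * x)| <= c * N * xi ^+ 3 * `|f x| +
    (p / (2 * e1) * H x + e1 * c ^+ 2 * p * xi * L x).
  have L0 : 0 <= L x by rewrite invr_ge0 addr_ge0// sqr_ge0.
  have nn1 : 0 <= c * N * xi ^+ 3 * `|f x|.
    by rewrite !mulr_ge0// exprn_ge0// ltW.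
  have nn2 : 0 <= e1 * c ^+ 2 * p * xi * L x.
    have := ltW e10; have := ltW p0; have := ltW xi0 => *.
    by do 4![apply: mulr_ge0 => //]; exact: sqr_ge0.
  rewrite /H patchE; case: ifPn => [|_].
    rewrite inE/= in_itv/= -ler_norml => xn.
    rewrite subrr mulr0 add0r -[leLHS]addr0 lerD// normrM [leLHS]mulrC ler_wpM2r//.
    rewrite (le_trans (kc3 _))// -[c * N * _]mulrA ler_wpM2l// normrM (gtr0_norm xi0) exprMn.
    by rewrite mulrC ler_wpM2r ?exprn_ge0 ?(ltW xi0)// lerXn2r ?nnegrE.
  rewrite subr0 -[leLHS]add0r; apply: lerD nn1 _.
  have r13 : 1 <= r <= 3 by rewrite /r; apply/andP; split; lra.
  have := weighted_kernel_sqr x xi0 r13 c0 kc kc3.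
  have -> : (c * xi `^ r) ^+ 2 = c ^+ 2 * (p ^+ 2 * xi) by rewrite exprMn rp.
  rewrite -/(L x) fh.
  set g := k (xi * x) * japanese x `^ (- r); set hx := h x.
  have -> : `|japanese x `^ (- r) * hx * k (xi * x)| = `|hx| * `|g|.
    by rewrite -normrM /g; congr `|_|; ring.
  rewrite -(real_normK (num_real g)) -(real_normK (num_real hx)).
  set u := `|hx|; set v := `|g| => vle.
  have : 0 <= (p * u - e1 * v) ^+ 2 by exact: sqr_ge0.
  have -> : p / (2 * e1) * u ^+ 2 + e1 * c ^+ 2 * p * xi * L x =
    (p ^+ 2 * u ^+ 2 + e1 ^+ 2 * (2 * (c ^+ 2 * (p ^+ 2 * xi)) * L x)) / (2 * e1 * p).
    by field; rewrite (gt_eqF p0) (gt_eqF e10).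
  rewrite ler_pdivlMr ?mulr_gt0// => sq.
  apply: (@le_trans _ _ (p ^+ 2 * u ^+ 2 + e1 ^+ 2 * v ^+ 2)); last first.
    by rewrite lerD2l ler_wpM2l ?sqr_ge0.
  by rewrite -subr_ge0; apply: le_trans sq _; rewrite le_eqVlt; apply/orP; left; apply/eqP; ring.
have fk1 : L1 (fun x => f x * k (xi * x)).
  apply: (@L1_le _ _ (fun x => c * `|f x|)).
  - apply: measurable_funM => //; apply: continuous_measurable_fun => x.
    apply: (@continuous_comp _ _ _ (fun y => xi * y) k); last exact: ck.
    by apply: cvgMl_tmp; exact: cvg_id.
  - by apply: L1Z; exact: (integrable_norm f1).
  - by move=> x; rewrite normrM mulrC ler_wpM2r.
have s1 : L1 (fun x => c * N * xi ^+ 3 * `|f x|) by apply: L1Z; exact: (integrable_norm f1).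
have s2 : L1 (fun x => p / (2 * e1) * H x) by exact: L1Z.
have s3 : L1 (fun x => e1 * c ^+ 2 * p * xi * L x) by exact: L1Z.
apply: le_trans (le_normr_Rintegral _ fk1) _ => //.
apply: (@le_trans _ _ (c * N * xi ^+ 3 * F1 + (p / (2 * e1) * \int[mu]_x H x +
    e1 * c ^+ 2 * p * xi * (pi / xi)))).
  rewrite -integral_lorentzR// /F1.
  rewrite -RintegralZl//; last exact: (integrable_norm f1).
  rewrite -RintegralZl// -RintegralZl// -RintegralD// -RintegralD//; last exact: L1D.
  apply: le_Rintegral => //; first exact: (integrable_norm fk1).
  by apply: L1D => //; exact: L1D.
have t1 : c * N * xi ^+ 3 * F1 <= e / 3 * p.
  have t10 : 0 <= c * N * F1 by rewrite mulr_ge0// mulr_ge0.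
  have h1 : c * N * F1 * xi <= e / 3.
    have : xi * (3 * (1 + c * N * F1)) <= e by rewrite -ler_pdivlMr// mulr_gt0// ltr_pwDl.
    by have := xi0; nra.
  apply: (@le_trans _ _ (c * N * F1 * (xi * p))).
    by rewrite mulrAC ler_wpM2l.
  by rewrite mulrA ler_wpM2r// ltW.
have t2 : p / (2 * e1) * \int[mu]_x H x <= e1 / 2 * p.
  apply: (@le_trans _ _ (p / (2 * e1) * e1 ^+ 2)).
    by rewrite ler_wpM2l// divr_ge0 ?mulr_ge0 ?ltW.
  by rewrite le_eqVlt; apply/orP; left; apply/eqP; field; rewrite gt_eqF.
have t3 : e1 * c ^+ 2 * p * xi * (pi / xi) = e1 * (c ^+ 2 * pi) * p.
  by field; rewrite gt_eqF.
rewrite t3.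
have small : e1 / 2 + e1 * (c ^+ 2 * pi) <= e / 3 by rewrite -e1E; lra.
apply: (le_trans (lerD t1 (lerD t2 (lexx _)))).
rewrite -!mulrDl ler_wpM2r ?(ltW p0)//; lra.
Unshelve. all: by end_near. Qed.

End DecayToSmoothness.

(** * Comparison with a power of the frequency *)
Section LittleO.
Context {R : realType}.
Implicit Types (f g h : R -> R) (a s c t xi : R).

Definition little_o s f := forall e : R, 0 < e ->
  \forall xi \near 0^'+, `|f xi| <= e * xi `^ s.

Lemma little_oD s f g : little_o s f -> little_o s g ->
  little_o s (fun xi => f xi + g xi).
Proof.
move=> fo go e e0; have e20 : 0 < e / 2 by rewrite divr_gt0.
near=> xi; apply: le_trans (ler_normD _ _) _.
rewrite [e]splitr mulrDl lerD//.
- by near: xi; exact: fo.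
- by near: xi; exact: go.
Unshelve. all: by end_near. Qed.

Lemma little_oZ s c f : little_o s f -> little_o s (fun xi => c * f xi).
Proof.
move=> fo e e0; have c0 : 0 < 1 + `|c| by rewrite ltr_pwDl.
near=> xi; have fxi : `|f xi| <= e / (1 + `|c|) * xi `^ s.
  by near: xi; apply: fo; rewrite divr_gt0.
rewrite normrM (le_trans (ler_wpM2l (normr_ge0 c) fxi))// mulrA ler_wpM2r ?powR_ge0//.
by rewrite mulrA ler_pdivrMr// mulrC ler_pM2l// lerDr.
Unshelve. all: by end_near. Qed.

Lemma little_oB s f g : little_o s f -> little_o s g ->
  little_o s (fun xi => f xi - g xi).
Proof.
move=> fo go; have := little_oD fo (little_oZ (-1) go).
by under [X in little_o s X]eq_fun do rewrite mulN1r.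
Qed.

Lemma little_o_dilate s f : little_o s f -> little_o s (fun xi => f (2 * xi)).
Proof.
move=> fo e e0; have p0 : 0 < 2 `^ s :> R by exact: powR_gt0.
have [d /= d0 fd] := fo (e / 2 `^ s) (divr_gt0 e0 p0).
exists (d / 2) => /=; first by rewrite divr_gt0.
move=> xi /= xid xi0; have xi20 : 0 < 2 * xi by rewrite mulr_gt0.
move: xid; rewrite sub0r normrN gtr0_norm// => xid.
have dxi : ball_ Num.norm 0 d (2 * xi).
  by rewrite /= sub0r normrN gtr0_norm//; lra.
apply: (le_trans (fd _ dxi xi20)).
by rewrite powRM ?(ltW xi0)// mulrA divfK// gt_eqF.
Qed.

Lemma little_o_mul_cvg0 s f g : (\forall xi \near 0^'+, `|f xi| <= xi `^ s * `|g xi|) ->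
  g xi @[xi --> 0^'+] --> (0 : R) -> little_o s f.
Proof.
move=> fg /cvgr0_norm_le g0 e e0; near=> xi.
have h : `|f xi| <= xi `^ s * `|g xi| by near: xi.
apply: le_trans h _; rewrite mulrC ler_wpM2r ?powR_ge0//.
by near: xi; exact: g0.
Unshelve. all: by end_near. Qed.

(** The form in which every error term of the expansions below appears: one
    factor bounded by [xi^s] times a coefficient, the product of the
    coefficient with the other factor tending to 0. *)
Lemma little_o_factor s f g h :
  (\forall xi \near 0^'+, `|f xi| <= xi `^ s * g xi) ->
  g xi * h xi @[xi --> 0^'+] --> (0 : R) -> little_o s (fun xi => f xi * h xi).
Proof.
move=> fg gh; apply: little_o_mul_cvg0 gh; apply: filterS fg => xi fgx.
rewrite normrM (le_trans (ler_wpM2r (normr_ge0 _) fgx))// -mulrA.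
by rewrite ler_wpM2l ?powR_ge0// normrM ler_wpM2r// ler_norm.
Qed.

Lemma little_o_eq s f g : (\forall xi \near 0^'+, f xi = g xi) ->
  little_o s f -> little_o s g.
Proof. by move=> fg fo e e0; apply: filterS2 fg (fo e e0) => xi ->. Qed.

Lemma little_o_monomial s c : little_o s (fun xi => c * xi `^ s) -> c = 0.
Proof.
move=> co; apply/eqP; rewrite -normr_le0; apply/ler_addgt0Pr => e e0; rewrite add0r.
near (0 : R)^'+ => xi.
have xi0 : 0 < xi by near: xi; exact: nbhs_right_gt.
have p0 : 0 < xi `^ s by exact: powR_gt0.
have : `|c * xi `^ s| <= e * xi `^ s by near: xi; exact: co.
by rewrite normrM (gtr0_norm p0) ler_pM2r.
Unshelve. all: by end_near. Qed.

End LittleO.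

(** * Expansion of the linear flow at frequency zero *)
Section FlowAtZero.
Context {R : realType}.
Implicit Types (A B : R -> R) (a s t xi p q : R).

Lemma flow_add a s t A B xi :
  flowRe a (s + t) A B xi = flowRe a s (flowRe a t A B) (flowIm a t A B) xi /\
  flowIm a (s + t) A B xi = flowIm a s (flowRe a t A B) (flowIm a t A B) xi.
Proof.
rewrite /flowRe /flowIm !mulrDl opprD expRD cosD sinD.
by split; ring.
Qed.

Lemma cvg_right_id : xi @[xi --> (0 : R)^'+] --> (0 : R).
Proof. by apply: cvg_at_right_filter; exact: cvg_id. Qed.

Lemma flow_cvg0 a t A B p q : 0 < a -> 0 <= t ->
  A xi @[xi --> 0^'+] --> p -> B xi @[xi --> 0^'+] --> q ->
  flowRe a t A B xi @[xi --> 0^'+] --> p /\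
  flowIm a t A B xi @[xi --> 0^'+] --> q.
Proof.
move=> a0 t0 Ap Bq.
have cp : xi `^ (1 + a) @[xi --> (0 : R)^'+] --> (0 : R).
  by apply: powR_cvg0; rewrite addr_gt0.
have ce : expR (- (t * `|xi| `^ (1 + a))) @[xi --> (0 : R)^'+] --> (1 : R).
  apply/subr_cvg0; apply: norm_cvg0.
  have ct : t * xi `^ (1 + a) @[xi --> (0 : R)^'+] --> (0 : R).
    by rewrite -[X in _ --> X](mulr0 t); exact: cvgMl_tmp.
  apply: squeeze_cvgr (cvg_cst 0) ct; near=> xi.
  have xi0 : 0 < xi by near: xi; exact: nbhs_right_gt.
  rewrite normr_ge0 (gtr0_norm xi0)/=.
  have tp : 0 <= t * xi `^ (1 + a) by rewrite mulr_ge0 ?powR_ge0.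
  by have [_ _ ] := expRB1_bounds tp.
have cth : t * xi * `|xi| @[xi --> (0 : R)^'+] --> (0 : R).
  have z : t * 0 * `|0 : R| = 0 :> R by rewrite normr0 mulr0.
  rewrite -[X in _ --> X]z; apply: cvg_at_right_filter.
  apply: cvgM; first by apply: cvgMl_tmp; exact: cvg_id.
  exact: norm_continuous.
have cc : cos (t * xi * `|xi|) @[xi --> (0 : R)^'+] --> (1 : R).
  by rewrite -[X in _ --> X](@cos0 R); apply: (cvg_comp _ _ cth); exact: continuous_cos.
have cs : sin (t * xi * `|xi|) @[xi --> (0 : R)^'+] --> (0 : R).
  by rewrite -[X in _ --> X](@sin0 R); apply: (cvg_comp _ _ cth); exact: continuous_sin.
split.
- rewrite -[p]mul1r -[X in _ * X]addr0 -[X in X + _]mul1r -[X in _ + X](mul0r q).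
  by apply: cvgM => //; apply: cvgD; exact: cvgM.
- rewrite -[q]mul1r -[X in _ * X]subr0 -[X in X - _]mul1r -[X in _ - X](mul0r p).
  by apply: cvgM => //; apply: cvgB; exact: cvgM.
Unshelve. all: by end_near. Qed.

End FlowAtZero.

Section LinearFlowExpansion.
Context {R : realType}.
Implicit Types (A B C : R -> R) (a t c xi K : R).

(** As [a <= 1], the phase [t xi^2] is dominated by [t xi^(1 + a)], so both parts
    of the exponent are measured by the same power. *)
Lemma flow_bounds a t xi : 0 < a -> a <= 1 -> 0 <= t -> 0 < xi <= 1 ->
  let e := expR (- (t * `|xi| `^ (1 + a))) in
  let th := t * xi * `|xi| in
  let p := xi `^ (1 + a) in
  [/\ `|e| <= 1, `|e - 1| <= t * p, `|e - 1 + t * p| <= p * (t ^+ 2 * p),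
      `|th| <= t * p &
      [/\ `|sin th| <= t * p, `|cos th - 1| <= p * (t ^+ 2 * p) &
          `|sin th - th| <= p * (t ^+ 3 * p)]].
Proof.
move=> a0 a1 t0 xi01; have /andP[xi0 xi1] := xi01.
rewrite (gtr0_norm xi0)/= -[t * xi * xi]mulrA.
set p := xi `^ (1 + a).
have p0 : 0 <= p by exact: powR_ge0.
have p1 : p <= 1 by rewrite -[leRHS](powRr0 xi); apply: ger_powR => //; lra.
have tp0 : 0 <= t * p by rewrite mulr_ge0.
have [e0 e1 eB eB2] := expRB1_bounds tp0.
have p2 : xi ^+ 2 <= p := sqr_le_powR xi01 a1.
set th := t * (xi * xi).
have th0 : 0 <= th by rewrite mulr_ge0// mulr_ge0// ltW.
have thp : th <= t * p by rewrite /th -expr2 ler_wpM2l.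
have thn : `|th| <= t * p by rewrite ger0_norm.
split => //; first by rewrite ger0_norm.
  by rewrite [leRHS](_ : _ = (t * p) ^+ 2)//; ring.
split.
- exact: le_trans (norm_sin_le _) thn.
- apply: le_trans (norm_cosB1_le _) _.
  have -> : p * (t ^+ 2 * p) = (t * p) ^+ 2 by ring.
  by rewrite lerXn2r ?nnegrE.
- apply: le_trans (norm_sinB_le _) _.
  apply: (@le_trans _ _ ((t * p) ^+ 3)); first by rewrite lerXn2r ?nnegrE.
  have -> : p * (t ^+ 3 * p) = t ^+ 3 * p ^+ 2 * 1 by ring.
  have -> : (t * p) ^+ 3 = t ^+ 3 * p ^+ 2 * p by ring.
  by rewrite ler_wpM2l// mulr_ge0 ?sqr_ge0// exprn_ge0.
Qed.

(** [A + i B] is a transform at the initial time; [c] is the mass, and [B]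
    vanishes at frequency zero because the function is real. *)
Context (a t c : R) (a0 : 0 < a) (a1 : a <= 1) (t0 : 0 <= t).
Context (A B : R -> R).
Hypothesis Ac : A xi @[xi --> 0^'+] --> c.
Hypothesis B0 : B xi @[xi --> 0^'+] --> (0 : R).

Let near01 : \forall xi \near (0 : R)^'+, 0 < xi <= 1.
Proof.
near=> xi; apply/andP; split; near: xi; first exact: nbhs_right_gt.
exact: nbhs_right_le.
Unshelve. all: by end_near. Qed.

Let cvgp : xi `^ (1 + a) @[xi --> (0 : R)^'+] --> (0 : R).
Proof. by apply: powR_cvg0; rewrite addr_gt0. Qed.

Let cvgMc (g h : R -> R) (k l : R) : g xi @[xi --> 0^'+] --> (0 : R) ->
  h xi @[xi --> 0^'+] --> l -> (k * g xi) * h xi @[xi --> 0^'+] --> (0 : R).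
Proof.
move=> g0 hl; have z : k * 0 * l = 0 by rewrite mulr0 mul0r.
rewrite -[X in _ --> X]z.
by apply: cvgM => //; exact: cvgMl_tmp.
Qed.

Let cvgkM (h : R -> R) (k : R) : h xi @[xi --> 0^'+] --> (0 : R) ->
  k * h xi @[xi --> 0^'+] --> (0 : R).
Proof. by move=> h0; rewrite -[X in _ --> X](mulr0 k); exact: cvgMl_tmp. Qed.

Let cA0 : c - A xi @[xi --> 0^'+] --> (0 : R).
Proof. by rewrite -[X in _ --> X](subrr c); apply: cvgB => //; exact: cvg_cst. Qed.

(** Only [- t |xi|^(1 + a)] from the dissipative factor survives, multiplied by
    [c]; the dispersive phase enters the real part through [cos - 1], which is of
    second order, and through [sin] times [B], which tends to 0. *)
Lemma flowRe_expansion :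
  little_o (1 + a) (fun xi => flowRe a t A B xi - A xi + t * c * xi `^ (1 + a)).
Proof.
pose e xi := expR (- (t * `|xi| `^ (1 + a))).
pose th xi := t * xi * `|xi|.
pose p xi := xi `^ (1 + a).
have o1 : little_o (1 + a) (fun xi => (e xi - 1 + t * p xi) * A xi).
  apply: little_o_factor (cvgMc (t ^+ 2) cvgp Ac); apply: filterS near01 => xi xi01.
  by have [_ _ h _ _] := flow_bounds a0 a1 t0 xi01.
have o2 : little_o (1 + a) (fun xi => t * p xi * (c - A xi)).
  apply: little_o_factor (cvgkM t cA0); apply: filterS near01 => xi xi01.
  by rewrite [leRHS]mulrC ger0_norm// mulr_ge0// powR_ge0.
have o3 : little_o (1 + a) (fun xi => e xi * (cos (th xi) - 1) * A xi).
  apply: little_o_factor (cvgMc (t ^+ 2) cvgp Ac); apply: filterS near01 => xi xi01.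
  have [en _ _ _ [_ h _]] := flow_bounds a0 a1 t0 xi01.
  by rewrite normrM -[leRHS]mul1r ler_pM.
have o4 : little_o (1 + a) (fun xi => e xi * sin (th xi) * B xi).
  apply: little_o_factor (cvgkM t B0); apply: filterS near01 => xi xi01.
  have [en _ _ _ [h _ _]] := flow_bounds a0 a1 t0 xi01.
  by rewrite normrM [leRHS]mulrC -[leRHS]mul1r ler_pM.
apply: little_o_eq (little_oD (little_oD o1 o2) (little_oD o3 o4)).
by apply: nearW => xi; rewrite /flowRe -/(e xi) -/(th xi) -/(p xi); ring.
Qed.

(** Here the phase enters through [- sin (t xi^2)] times [A], and [A] tends to
    [c]. When [a < 1] the term [t c xi^2] is itself negligible; the expansion is
    used for [a = 1]. *)
Lemma flowIm_expansion :
  little_o (1 + a) (fun xi => flowIm a t A B xi - B xi + t * c * xi ^+ 2).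
Proof.
pose e xi := expR (- (t * `|xi| `^ (1 + a))).
pose th xi := t * xi * `|xi|.
pose p xi := xi `^ (1 + a).
have o1 : little_o (1 + a) (fun xi => (e xi - 1) * B xi).
  apply: little_o_factor (cvgkM t B0); apply: filterS near01 => xi xi01.
  by have [_ h _ _ _] := flow_bounds a0 a1 t0 xi01; rewrite [leRHS]mulrC.
have o2 : little_o (1 + a) (fun xi => e xi * (cos (th xi) - 1) * B xi).
  apply: little_o_factor (cvgMc (t ^+ 2) cvgp B0); apply: filterS near01 => xi xi01.
  have [en _ _ _ [_ h _]] := flow_bounds a0 a1 t0 xi01.
  by rewrite normrM -[leRHS]mul1r ler_pM.
have o3 : little_o (1 + a) (fun xi => (e xi - 1) * sin (th xi) * A xi).
  apply: little_o_factor (cvgMc (t ^+ 2) cvgp Ac); apply: filterS near01 => xi xi01.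
  have [_ h1 _ _ [h2 _ _]] := flow_bounds a0 a1 t0 xi01.
  have -> : xi `^ (1 + a) * (t ^+ 2 * xi `^ (1 + a)) =
    (t * xi `^ (1 + a)) * (t * xi `^ (1 + a)) by ring.
  by rewrite normrM ler_pM.
have o4 : little_o (1 + a) (fun xi => (sin (th xi) - th xi) * A xi).
  apply: little_o_factor (cvgMc (t ^+ 3) cvgp Ac); apply: filterS near01 => xi xi01.
  by have [_ _ _ _ [_ _ h]] := flow_bounds a0 a1 t0 xi01.
have o5 : little_o (1 + a) (fun xi => th xi * (c - A xi)).
  apply: little_o_factor (cvgkM t cA0); apply: filterS near01 => xi xi01.
  by have [_ _ _ h _] := flow_bounds a0 a1 t0 xi01; rewrite [leRHS]mulrC.
apply: little_o_eq (little_oB (little_oD o1 (little_oD o2 o5)) (little_oD o3 o4)).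
apply: filterS near01 => xi /andP[xi0 _].
have -> : t * c * xi ^+ 2 = th xi * c by rewrite /th gtr0_norm//; ring.
by rewrite /flowIm -/(e xi) -/(th xi) -/(p xi); ring.
Qed.

End LinearFlowExpansion.

(** * Finite differences of the transform of a decaying function *)
Section Obstruction.
Context {R : realType}.
Local Notation mu := (@lebesgue_measure R).
Local Notation L1 f := (mu.-integrable setT (EFin \o f)).
Implicit Types (f : R -> R) (a t T c y xi : R) (u : R -> R -> R).

(** The combination is [2 (cos y - 1)^2], so it vanishes to fourth order. *)
Lemma cos_defect_bounds y :
  `|cos (2 * y) - 4 * cos y + 3| <= 8 /\
  `|cos (2 * y) - 4 * cos y + 3| <= 8 * `|y| ^+ 3.
Proof.
have -> : cos (2 * y) - 4 * cos y + 3 = 2 * (cos y - 1) ^+ 2 :> R.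
  by rewrite mulr_natl cos_mulr2n mulr2n; ring.
have b1 : `|cos y - 1| <= 2 :> R.
  by rewrite ler_norml; have := cos_geN1 y; have := cos_le1 y => *; apply/andP; split; lra.
have b2 := norm_cosB1_le y.
rewrite normrM normrX (ger0_norm (_ : 0 <= 2))//.
have n0 : 0 <= `|cos y - 1| by [].
move: b1 b2 n0; rewrite -(real_normK (num_real y)).
have := normr_ge0 y; set n := `|cos y - 1|; set m := `|y| => m0 b1 b2 n0.
split; first by nra.
have [m1|m1] := leP m 1.
  have : n ^+ 2 <= (m ^+ 2) ^+ 2 by rewrite lerXn2r ?nnegrE ?sqr_ge0.
  have : (m ^+ 2) ^+ 2 <= m ^+ 3 by rewrite -exprM; apply: ler_wiXn2l.
  have : 0 <= m ^+ 3 by rewrite exprn_ge0.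
  by set x3 := m ^+ 3; set x4 := (m ^+ 2) ^+ 2; set x2 := n ^+ 2 => *; lra.
have : 1 <= m ^+ 3 by rewrite exprn_ege1// ltW.
have : n ^+ 2 <= 2 ^+ 2 by rewrite lerXn2r ?nnegrE.
by set x3 := m ^+ 3; set x2 := n ^+ 2 => *; lra.
Qed.

(** The combination is [2 sin y (cos y - 1)], so it vanishes to third order. *)
Lemma sin_defect_bounds y :
  `|sin (2 * y) - 2 * sin y| <= 8 /\
  `|sin (2 * y) - 2 * sin y| <= 8 * `|y| ^+ 3.
Proof.
have -> : sin (2 * y) - 2 * sin y = 2 * (sin y * (cos y - 1)) :> R.
  by rewrite mulr_natl sin_mulr2n mulr2n; ring.
have b1 : `|cos y - 1| <= 2 :> R.
  by rewrite ler_norml; have := cos_geN1 y; have := cos_le1 y => *; apply/andP; split; lra.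
have b2 := norm_cosB1_le y.
have s1 : `|sin y| <= 1 := sin_max y.
have s2 := norm_sin_le y.
rewrite !normrM (ger0_norm (_ : 0 <= 2))//; split.
  have : `|sin y| * `|cos y - 1| <= 1 * 2 by exact: ler_pM.
  by lra.
have : `|sin y| * `|cos y - 1| <= `|y| * `|y| ^+ 2.
  by apply: ler_pM => //; rewrite real_normK// num_real.
rewrite -exprS; have : 0 <= `|y| ^+ 3 by rewrite exprn_ge0.
by set x3 := `|y| ^+ 3; set q := _ * _ => *; lra.
Qed.

Lemma continuous_dilation (k : R -> R) : continuous k -> continuous (fun y => k (2 * y)).
Proof.
move=> ck y; apply: (@continuous_comp _ _ _ (fun y => 2 * y) k); last exact: ck.
by apply: cvgMl_tmp; exact: cvg_id.
Qed.

Lemma cos_transform_little_o a f : 0 < a -> a <= 1 -> in_weighted_L2 (3 / 2 + a) f ->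
  little_o (1 + a) (fun xi => osc_transform cos f (2 * xi) -
    4 * osc_transform cos f xi + 3 * osc_transform cos f 0).
Proof.
move=> a0 a1 fw.
have f1 : L1 f by apply/weighted_L2_L1/(weighted_L2S _ fw); lra.
have E xi : osc_transform cos f (2 * xi) - 4 * osc_transform cos f xi + 3 * osc_transform cos f 0 =
    \int[mu]_x (f x * (cos (2 * (xi * x)) - 4 * cos (xi * x) + 3)).
  have i1 := L1_osc_scaled oscillating_cos (2 * xi) f1.
  have i2 := L1Z 4 (L1_osc_scaled oscillating_cos xi f1).
  have i3 := L1Z 3 (L1_osc_scaled oscillating_cos 0 f1).
  rewrite /osc_transform -RintegralZl//; last exact: (L1_osc_scaled oscillating_cos xi f1).
  rewrite -RintegralZl//; last exact: (L1_osc_scaled oscillating_cos 0 f1).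
  rewrite -RintegralB// -RintegralD//; last exact: L1B.
  by apply: eq_Rintegral => x _; rewrite mul0r cos0 -(mulrA 2 xi x); ring.
move=> e e0; have := @kernel_little_o _ (fun y => cos (2 * y) - 4 * cos y + 3) 8 a f e a0 a1.
have ck : continuous (fun y : R => cos (2 * y) - 4 * cos y + 3).
  move=> y; apply: cvgD; last exact: cvg_cst; apply: cvgB.
    by apply: continuous_dilation; exact: continuous_cos.
  by apply: cvgMl_tmp; exact: continuous_cos.
move=> /(_ _ ck (fun y => (cos_defect_bounds y).1) (fun y => (cos_defect_bounds y).2) fw e0).
by move=> /(_ (ler0n _ 8)); apply: filterS => xi; rewrite E.
Qed.

Lemma sin_transform_little_o a f : 0 < a -> a <= 1 -> in_weighted_L2 (3 / 2 + a) f ->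
  little_o (1 + a) (fun xi => osc_transform sin f (2 * xi) - 2 * osc_transform sin f xi).
Proof.
move=> a0 a1 fw.
have f1 : L1 f by apply/weighted_L2_L1/(weighted_L2S _ fw); lra.
have E xi : osc_transform sin f (2 * xi) - 2 * osc_transform sin f xi =
    \int[mu]_x (f x * (sin (2 * (xi * x)) - 2 * sin (xi * x))).
  have i1 := L1_osc_scaled oscillating_sin (2 * xi) f1.
  have i2 := L1Z 2 (L1_osc_scaled oscillating_sin xi f1).
  rewrite /osc_transform -RintegralZl//; last exact: (L1_osc_scaled oscillating_sin xi f1).
  rewrite -RintegralB//.
  by apply: eq_Rintegral => x _; rewrite -(mulrA 2 xi x); ring.
move=> e e0; have := @kernel_little_o _ (fun y => sin (2 * y) - 2 * sin y) 8 a f e a0 a1.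
have ck : continuous (fun y : R => sin (2 * y) - 2 * sin y).
  move=> y; apply: cvgB.
    by apply: continuous_dilation; exact: continuous_sin.
  by apply: cvgMl_tmp; exact: continuous_sin.
move=> /(_ _ ck (fun y => (sin_defect_bounds y).1) (fun y => (sin_defect_bounds y).2) fw e0).
by move=> /(_ (ler0n _ 8)); apply: filterS => xi; rewrite E.
Qed.

End Obstruction.

(** * Vanishing of the mass *)
Section Conclusion.
Context {R : realType}.
Implicit Types (a t T c xi : R).
Context (a T : R) (phi : R -> R) (u : R -> R -> R).
Hypotheses (a_gt0 : 0 < a) (a_le1 : a <= 1) (T_gt0 : 0 < T).
Hypotheses (u_cont : continuous_in_Z 1 1 T u) (u_sol : is_solution a T phi u).

(** The transform of [u t] is [C t - i S t], and [V t + i W t] is the linear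
    evolution of the transform of [u 0]. *)
Let C t := osc_transform cos (u t).
Let S t := osc_transform sin (u t).
Let V t := flowRe a t (C 0) (fun xi => - S 0 xi).
Let W t := flowIm a t (C 0) (fun xi => - S 0 xi).
Let c := C 0 0.

Let uw t : t \in `[0, T] -> in_weighted_L2 1 (u t).
Proof. by move=> /(u_cont.1 t)[]. Qed.

Let zT : (0 : R) \in `[0, T]. Proof. by rewrite in_itv/= lexx ltW. Qed.

Lemma osc_transform_sin0 (f : R -> R) : osc_transform sin f 0 = 0.
Proof.
rewrite /osc_transform; under eq_Rintegral do rewrite mul0r sin0 mulr0.
by rewrite Rintegral_cst//= mul0r.
Qed.

Let cvgC t : t \in `[0, T] -> C t xi @[xi --> 0^'+] --> C t 0.
Proof.
move=> tT; apply: cvg_at_right_filter; apply: continuous_osc_transform.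
  exact: oscillating_cos.
exact: weighted_L2_L1 (uw tT).
Qed.

Let cvgVW t : t \in `[0, T] -> V t xi @[xi --> 0^'+] --> c /\
  W t xi @[xi --> 0^'+] --> (0 : R).
Proof.
move=> tT; apply: flow_cvg0 => //.
- by move: tT; rewrite in_itv/= => /andP[].
- exact: cvgC.
- have s0 : - S 0 0 = 0 by rewrite /S osc_transform_sin0 oppr0.
  rewrite -[X in _ --> X]s0; apply: cvgN.
  apply: cvg_at_right_filter; apply: continuous_osc_transform.
    exact: oscillating_sin.
  exact: weighted_L2_L1 (uw zT).
Qed.

Let near8 : \forall xi \near (0 : R)^'+, 0 < xi <= 8^-1.
Proof.
near=> xi; apply/andP; split; near: xi; first exact: nbhs_right_gt.
by apply: nbhs_right_le; rewrite invr_gt0.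
Unshelve. all: by end_near. Qed.

(** The real part of the Duhamel term vanishes at frequency zero. *)
Lemma mass_conserved t : t \in `[0, T] -> C t 0 = c.
Proof.
move=> tT.
have [K K0 bounds] := duhamel_bounds a_gt0 a_le1 (ltW T_gt0) u_cont u_sol.
have cD : V t xi - C t xi @[xi --> 0^'+] --> (0 : R).
  have cK : K * xi ^+ 2 @[xi --> (0 : R)^'+] --> (0 : R).
    have z : K * 0 ^+ 2 = 0 by rewrite expr0n mulr0.
    rewrite -[X in _ --> X]z; apply: cvgMl_tmp; apply: cvg_at_right_filter.
    exact: exprn_continuous.
  apply: norm_cvg0; apply: squeeze_cvgr (cvg_cst 0) cK.
  by apply: filterS near8 => xi xi8; rewrite normr_ge0; have [] := bounds t xi tT xi8.
have cVC : V t xi - C t xi @[xi --> 0^'+] --> c - C t 0.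
  by apply: cvgB; [exact: (cvgVW tT).1|exact: cvgC].
have E : 0 = c - C t 0 := cvg_unique _ cD cVC.
by apply/esym/eqP; rewrite -subr_eq0 -E.
Qed.

(** By the group law, the flow from 0 to [t2] is that from [t1] to [t2] started
    from [V t1 + i W t1], so the expansion applies with the same mass [c]. *)
Lemma flow_between t1 t2 : t1 \in `[0, T] -> t1 <= t2 ->
  little_o (1 + a) (fun xi => V t2 xi - V t1 xi + (t2 - t1) * c * xi `^ (1 + a)) /\
  little_o (1 + a) (fun xi => W t2 xi - W t1 xi + (t2 - t1) * c * xi ^+ 2).
Proof.
move=> t1T t12; have d0 : 0 <= t2 - t1 by rewrite subr_ge0.
have [cV cW] := cvgVW t1T.
have E xi : V t2 xi = flowRe a (t2 - t1) (V t1) (W t1) xi /\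
    W t2 xi = flowIm a (t2 - t1) (V t1) (W t1) xi.
  by rewrite /V /W -{1 3}(subrK t1 t2); exact: flow_add.
split.
- apply: little_o_eq (flowRe_expansion a_gt0 a_le1 d0 cV cW).
  by apply: nearW => xi; rewrite (E xi).1.
- apply: little_o_eq (flowIm_expansion a_gt0 a_le1 d0 cV cW).
  by apply: nearW => xi; rewrite (E xi).2.
Qed.

(** The change of the transform between [t1] and [t2] is computed in two ways,
    from the linear expansion and from the decay of [u t1] and [u t2]. *)
Lemma mass_zero t1 t2 : t1 \in `[0, T] -> t2 \in `[0, T] -> t1 < t2 ->
  in_weighted_L2 (3 / 2 + a) (u t1) -> in_weighted_L2 (3 / 2 + a) (u t2) -> c = 0.
Proof.
move=> t1T t2T t12 u1w u2w.
have [K K0 bounds] := duhamel_bounds a_gt0 a_le1 (ltW T_gt0) u_cont u_sol.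
have [ER EI] := flow_between t1T (ltW t12).
have d0 : t2 - t1 != 0 by rewrite subr_eq0 gt_eqF.
move: a_le1; rewrite le_eqVlt => /predU1P[a1|a1].
(* For [a = 1] the imaginary part is used: its nonlinear contribution is linear
   in [xi] to leading order, and [g(2 xi) - 2 g(xi)] maps [xi^2] to [2 xi^2]. *)
- have Qo t : t \in `[0, T] -> little_o (1 + a)
      (fun xi => (W t (2 * xi) + S t (2 * xi)) - 2 * (W t xi + S t xi)).
    move=> tT; apply: (@little_o_mul_cvg0 _ _ _ (fun xi => K * xi)).
      apply: filterS near8 => xi xi8; have [_ /le_trans] := bounds t xi tT xi8; apply.
      by rewrite mulrCA ler_wpM2l ?powR_ge0// ler_norm.
    by rewrite -[X in _ --> X](mulr0 K); apply: cvgMl_tmp; exact: cvg_right_id.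
  have S1 := sin_transform_little_o a_gt0 a_le1 u1w.
  have S2 := sin_transform_little_o a_gt0 a_le1 u2w.
  have EI2 := little_oB (little_o_dilate EI) (little_oZ 2 EI).
  have all := little_oD (little_oB EI2 (little_oB (Qo t2 t2T) (Qo t1 t1T))) (little_oB S2 S1).
  have : little_o (1 + a) (fun xi => (2 * ((t2 - t1) * c)) * xi `^ (1 + a)).
    apply: little_o_eq all; apply: filterS near8 => xi /andP[xi0 _].
    rewrite a1 (_ : 1 + 1 = 2%:R)// powR_mulrn ?(ltW xi0)// /S; ring.
  move=> /little_o_monomial /eqP; rewrite mulf_eq0 pnatr_eq0/= mulf_eq0 (negbTE d0)/=.
  by move=> /eqP.
(* For [a < 1] the nonlinear contribution [O(xi^2)] to the real part is
   negligible, and [g(2 xi) - 4 g(xi) + 3 g(0)] maps [xi^(1 + a)] to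
   [(2^(1 + a) - 4) xi^(1 + a)]; the values at 0 cancel by conservation of
   mass. *)
- have Po t : t \in `[0, T] -> little_o (1 + a) (fun xi => V t xi - C t xi).
    move=> tT; apply: (@little_o_mul_cvg0 _ _ _ (fun xi => K * xi `^ (1 - a))).
      apply: filterS near8 => xi xi8; have [/le_trans + _] := bounds t xi tT xi8; apply.
      have /andP[xi0 _] := xi8.
      have -> : xi ^+ 2 = xi `^ (1 + a) * xi `^ (1 - a).
        rewrite -powRD ?(gt_eqF xi0) ?implybT// -powR_mulrn ?(ltW xi0)//.
        by congr (_ `^ _); ring.
      by rewrite mulrCA ler_wpM2l ?powR_ge0// ler_norm.
    by rewrite -[X in _ --> X](mulr0 K); apply: cvgMl_tmp; apply: powR_cvg0; rewrite subr_gt0.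
  have C1 := cos_transform_little_o a_gt0 a_le1 u1w.
  have C2 := cos_transform_little_o a_gt0 a_le1 u2w.
  have CC := little_oD (little_oB ER (Po t2 t2T)) (Po t1 t1T).
  have all := little_oB (little_oB (little_o_dilate CC) (little_oZ 4 CC)) (little_oB C2 C1).
  have : little_o (1 + a) (fun xi => ((2 `^ (1 + a) - 4) * ((t2 - t1) * c)) * xi `^ (1 + a)).
    apply: little_o_eq all; apply: filterS near8 => xi /andP[xi0 _].
    rewrite powRM ?(ltW xi0)//.
    have := mass_conserved t1T; have := mass_conserved t2T; rewrite /C => -> ->.
    ring.
  move=> /little_o_monomial /eqP; rewrite mulf_eq0 => /orP[|]; last first.
    by rewrite mulf_eq0 (negbTE d0)/= => /eqP.
  (* [2^(1 + a) = 4] would force [a = 1] *)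
  rewrite subr_eq0 => /eqP E; exfalso.
  have := congr1 (@ln R) E; rewrite ln_powR (_ : 4 = 2 `^ 2%:R); last first.
    by rewrite powR_mulrn//; ring.
  rewrite ln_powR => /(mulIf _) H; have ln2 : 0 < ln 2 :> R by apply: ln_gt0; lra.
  have := H ltac:(by rewrite gt_eqF); lra.
Qed.

End Conclusion.

Theorem theorem1p2 (R : realType) (a T : R) (phi : R -> R) (u : R -> R -> R)
    (a_gt0 : 0 < a) (a_le1 : a <= 1) (T_gt0 : 0 < T)
    (u_cont : continuous_in_Z 1 1 T u)
    (u_sol : is_solution a T phi u)
    (ex_times : exists t1 t2 : R,
      [/\ t1 \in `[0, T], t2 \in `[0, T], t1 != t2,
          in_Z (3 / 2 + a) (3 / 2 + a) (u t1) &
          in_Z (3 / 2 + a) (3 / 2 + a) (u t2)]) :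
  forall t : R, t \in `[0, T] -> fourier (u t) 0 = 0.
Proof.
have c0 : osc_transform cos (u 0) 0 = 0.
  have [t1 [t2 [t1T t2T t12 [_ u1] [_ u2]]]] := ex_times.
  have [lt12|lt21|E] := ltgtP t1 t2; last by rewrite E eqxx in t12.
    exact: (mass_zero a_gt0 a_le1 T_gt0 u_cont u_sol t1T t2T lt12 u1 u2).
  exact: (mass_zero a_gt0 a_le1 T_gt0 u_cont u_sol t2T t1T lt21 u2 u1).
move=> t tT; have Ct := mass_conserved a_gt0 a_le1 T_gt0 u_cont u_sol tT.
rewrite /fourier -/(osc_transform cos (u t) 0) -/(osc_transform sin (u t) 0).
by rewrite Ct c0 osc_transform_sin0 oppr0.
Qed.
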